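(* Let $d\in\mathbb{R}^n$. The Schur-Horn mapping (for Hermitian matrices) $F: S_d\to N_d/\sim$ is a continuous mapping from $S_d$ to $N_d/\sim$ equipped with the Hausdorff distance $d_{\mathrm H}$.
   Context: For $x\in\mathbb{R}^n$, $x^{\uparrow}$ denotes $x$ reordered in non-decreasing order. For $a,\lambda\in\mathbb{R}^n$, $\lambda\prec a$ means $\sum_{i=1}^k \lambda_i^{\uparrow}\le \sum_{i=1}^k a_i^{\uparrow}$ for $k=1,\dots,n-1$ and $\sum_{i=1}^n\lambda_i^{\uparrow}=\sum_{i=1}^n a_i^{\uparrow}$. For a matrix $A$, $\mathrm{diag}(A)$ is the vector of its diagonal entries and $A^*$ is its conjugate transpose. For $d\in\mathbb{R}^n$, $S_d=\{\Lambda\in\mathbb{R}^{n\times n}:\Lambda \text{ diagonal},\ \mathrm{diag}(\Lambda)\prec d\}$, with distances measured in the Frobenius norm $\|\cdot\|_{\mathrm F}$, and $N_d=\{A\in\mathbb{C}^{n\times n}: \mathrm{diag}(A)=d,\ A=A^*\}$. On $N_d$, $A_1\sim A_2$ if $A_1$ and $A_2$ have the same eigenvalues (with multiplicity); $[A]\subset N_d$ is the equivalence class of $A$. The Schur-Horn mapping is $F:S_d\to N_d/\sim$, $\Lambda\mapsto[Q\Lambda Q^*]$, where $Q$ is a unitary matrix such that $\mathrm{diag}(Q\Lambda Q^* )=d$ (such $Q$ exists by the Schur-Horn theorem). The Hausdorff distance on $N_d/\sim$ is $$d_{\mathrm H}([A_1],[A_2])=\max\Big\{\sup_{X\in[A_1]}\inf_{Y\in[A_2]}\|X-Y\|_{\mathrm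 F},\ \sup_{Y\in[A_2]}\inf_{X\in[A_1]}\|X-Y\|_{\mathrm F}\Big\}.$$ *)

(* Defs.v *)
From mathcomp Require Export all_boot all_order all_algebra.
From mathcomp Require Export complex.
From mathcomp Require Export boolp classical_sets functions reals ereal.

Set Implicit Arguments.
Unset Strict Implicit.
Unset Printing Implicit Defensive.

Import Order.TTheory GRing.Theory Num.Theory.

Local Open Scope ring_scope.
Local Open Scope classical_set_scope.
Local Open Scope complex_scope.
Local Open Scope sesquilinear_scope.

Section SchurHorn.
Context {R : realType} {n : nat}.
Implicit Types (x a l d : 'rV[R]_n) (L : 'M[R]_n) (A B Q X Y : 'M[R[i]]_n).

Definition sort_up x : 'rV[R]_n :=
  \row_(i < n) nth 0 (sort <=%R [seq x 0 j | j <- enum 'I_n]) i.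

Definition majorized l a : Prop :=
  (forall k : nat, (1 <= k <= n.-1)%N ->
     \sum_(i < n | (i < k)%N) sort_up l 0 i <=
     \sum_(i < n | (i < k)%N) sort_up a 0 i) /\
  \sum_(i < n) sort_up l 0 i = \sum_(i < n) sort_up a 0 i.

Definition diagv (K : Type) (A : 'M[K]_n) : 'rV[K]_n := \row_i A i i.

Definition complexify {m : nat} (A : 'M[R]_(m, n)) : 'M[R[i]]_(m, n) :=
  map_mx (fun t : R => t%:C) A.

Definition frobenius A : R :=
  Num.sqrt (\sum_i \sum_j ComplexField.Normc.normc (A i j) ^+ 2).

Definition Sd d : set 'M[R]_n :=
  [set L | is_diag_mx L /\ majorized (diagv L) d].

Definition Nd d : set 'M[R[i]]_n :=
  [set A | diagv A = complexify d /\ A = A^t*].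

(* [mup z p] is the multiplicity of [z] as a root of [p]. *)
Definition same_eigenvalues A B : Prop :=
  forall z : R[i], mup z (char_poly A) = mup z (char_poly B).

Definition eqclass d A : set 'M[R[i]]_n :=
  [set B | Nd d B /\ same_eigenvalues A B].

Definition Nquot d : set (set 'M[R[i]]_n) := [set eqclass d A | A in Nd d].

Definition unitary_conj Q L : 'M[R[i]]_n := Q *m complexify L *m Q^t*.

Definition is_schur_horn_unitary d L Q : Prop :=
  Q \is unitarymx /\ diagv (unitary_conj Q L) = complexify d.

(* A unitary [Q] as above is selected by choice; the default value [1%:M] is
   returned only if there is none. By [schur_horn_mapE], the resulting class
   does not depend on the selection. *)
Definition schur_horn_map d L : set 'M[R[i]]_n :=
  eqclass d (unitary_conj (xget 1%:M [set Q | is_schur_horn_unitary d L Q]) L).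

(* Extended-real suprema and infima are used so that no nonemptiness or
   boundedness side condition is needed for them to be meaningful. *)
Definition dist_hausdorff (C1 C2 : set 'M[R[i]]_n) : \bar R :=
  Order.max
    (ereal_sup [set ereal_inf [set (frobenius (X - Y))%:E | Y in C2] | X in C1])
    (ereal_sup [set ereal_inf [set (frobenius (X - Y))%:E | X in C1] | Y in C2]).

Definition continuous_on_Sd d (F : 'M[R]_n -> set 'M[R[i]]_n) : Prop :=
  forall L, Sd d L -> forall e : R, 0 < e ->
  exists2 delta : R, 0 < delta &
    forall L', Sd d L' -> frobenius (complexify (L' - L)) < delta ->
      (dist_hausdorff (F L') (F L) < e%:E)%E.

Lemma char_poly_unitary_conj Q L : Q \is unitarymx ->
  char_poly (unitary_conj Q L) = char_poly (complexify L).
Proof.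
move=> Qu; have Quu : Q *m Q^t* = 1%:M by apply/unitarymxP.
rewrite /char_poly /char_poly_mx /unitary_conj !map_mxM.
move: (complexify L) => A.
set P := map_mx polyC Q; set P' := map_mx polyC (Q^t*).
have PP' : P *m P' = 1%:M by rewrite -map_mxM Quu map_scalar_mx.
have -> : 'X%:M - P *m map_mx polyC A *m P' =
          P *m ('X%:M - map_mx polyC A) *m P'.
  by rewrite mulmxBr mulmxBl scalar_mxC -(mulmxA _ P) PP' mulmx1.
by rewrite !det_mulmx mulrAC -det_mulmx PP' det1 mul1r.
Qed.

Lemma schur_horn_mapE d L Q : is_schur_horn_unitary d L Q ->
  schur_horn_map d L = eqclass d (unitary_conj Q L).
Proof.
move=> QP; rewrite /schur_horn_map.
have [Q'u _] := @xgetPex _ 1%:M [set U | is_schur_horn_unitary d L U]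
  (ex_intro _ Q QP).
have [Qu _] := QP.
rewrite /eqclass /same_eigenvalues.
by rewrite (char_poly_unitary_conj L Q'u) (char_poly_unitary_conj L Qu).
Qed.

End SchurHorn.

(* Main.v *)
Require Import Defs.
From mathcomp Require Import fingroup perm zify ring lra.
From mathcomp Require Import topology normedtype.

(** The fiber [F(L)] consists of the matrices [U L U^*] with [U] unitary and
    diagonal [d], so by compactness of the unitary group everything reduces to
    a pointwise statement: given [A] in [F(L)] and [L'] in [S_d] close to [L],
    find a matrix of [F(L')] close to [A].

    Diagonalize [A] as [V^* l V] with a unitary [V] that is compatible with the
    decomposition of [A] into irreducible blocks, let [y] be the diagonal of
    [V d V^*], and put [x = (1 - t) l + t y].  If [L'] is close enough to [L]
    with respect to [t], the vector [x] is still averaged enough to be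
    reachable from [L']: an inequality of the majorization [l < d] is either
    strict, hence improved by the step towards [y], or an equality, and then it
    persists because [L' < d].  The Schur-Horn theorem gives [H] with the
    spectrum of [L'] and diagonal [x], and [H] is close to [l] because
    [|H - l|^2 = |L'|^2 - 2 <x, l> + |l|^2].  So [V^* H V] is close to [A], and on
    every irreducible block its diagonal has the same sum as [d].  The small
    errors left inside a block are moved along paths of nonzero entries of [A]
    by plane rotations close to the identity. *)

Set Implicit Arguments.
Unset Strict Implicit.
Unset Printing Implicit Defensive.

Import Order.TTheory GRing.Theory Num.Theory.
Import numFieldNormedType.Exports.

Local Open Scope classical_set_scope.
Local Open Scope ring_scope.
Local Open Scope sesquilinear_scope.

(** * Entrywise bounds and plane rotations *)

Section Entrywise.
Variable C : numClosedFieldType.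

Definition mxle m n (A : 'M[C]_(m, n)) (e : C) := forall i j, `|A i j| <= e.

Lemma mxle_trans m n (A : 'M[C]_(m, n)) e f : mxle A e -> e <= f -> mxle A f.
Proof. by move=> Ae ef i j; apply: le_trans (Ae i j) ef. Qed.

Lemma mxleD m n (A B : 'M[C]_(m, n)) e f :
  mxle A e -> mxle B f -> mxle (A + B) (e + f).
Proof.
by move=> Ae Bf i j; rewrite mxE (le_trans (ler_normD _ _))// lerD.
Qed.

Lemma mxle_distC m n (A B : 'M[C]_(m, n)) e : mxle (A - B) e -> mxle (B - A) e.
Proof. by move=> AB i j; have := AB i j; rewrite !mxE distrC. Qed.

Lemma mxle_dist_trans m n (A B D : 'M[C]_(m, n)) e f :
  mxle (A - B) e -> mxle (B - D) f -> mxle (A - D) (e + f).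
Proof. by move=> AB BD; rewrite -(subrKA B); apply: mxleD. Qed.

Lemma mxleM m n p (A : 'M[C]_(m, n)) (B : 'M[C]_(n, p)) e f :
  mxle A e -> mxle B f -> mxle (A *m B) (n%:R * (e * f)).
Proof.
move=> Ae Bf i j; rewrite mxE (le_trans (ler_norm_sum _ _ _))//.
apply: (@le_trans _ _ (\sum_(k < n) e * f)).
  by apply: ler_sum => k _; rewrite normrM ler_pM.
by rewrite sumr_const card_ord mulr_natl.
Qed.

Lemma mxle_adj m n (A : 'M[C]_(m, n)) e : mxle A e -> mxle (A^t*) e.
Proof. by move=> Ae i j; rewrite !mxE norm_conjC. Qed.

Lemma adjmxM m n p (A : 'M[C]_(m, n)) (B : 'M[C]_(n, p)) :
  (A *m B)^t* = B^t* *m A^t*.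
Proof. by rewrite trmx_mul map_mxM. Qed.

Lemma adjmxB m n (A B : 'M[C]_(m, n)) : (A - B)^t* = A^t* - B^t*.
Proof. by rewrite linearB map_mxB. Qed.

Lemma adjmx1 n : (1%:M)^t* = 1%:M :> 'M[C]_n.
Proof. by rewrite trmx1 map_mx1. Qed.

Lemma unitarymxK n (U : 'M[C]_n) : U \is unitarymx -> U^t* *m U = 1%:M.
Proof. by move=> /unitarymxP /mulmx1C. Qed.

Lemma unitarymx1 n : (1%:M : 'M[C]_n) \is unitarymx.
Proof. by apply/unitarymxP; rewrite adjmx1 mulmx1. Qed.

Lemma mxle_unitary m n (U : 'M[C]_(m, n)) : U \is unitarymx -> mxle U 1.
Proof.
move=> /unitarymxP UU i j.
have := congr1 (fun A : 'M_m => A i i) UU; rewrite !mxE eqxx mulr1n => UU1.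
rewrite -(@expr_le1 _ 2)// -UU1 (bigD1 j)//= !mxE -normCK lerDl.
by apply: sumr_ge0 => k _; rewrite !mxE -normCK exprn_ge0.
Qed.

Lemma mxle_conjmx n (U A B : 'M[C]_n) e : U \is unitarymx ->
  mxle (A - B) e ->
  mxle (U *m A *m U^t* - U *m B *m U^t*) (n%:R * (n%:R * e)).
Proof.
move=> Uu AB; rewrite -mulmxBl -mulmxBr.
have U1 := mxle_unitary Uu.
by have := mxleM (mxleM U1 AB) (mxle_adj U1); rewrite mul1r mulr1.
Qed.

Lemma mxle_conjmx_near1 n (G B : 'M[C]_n) e M : G \is unitarymx ->
  mxle (G - 1%:M) e -> mxle B M ->
  mxle (G *m B *m G^t* - B) (n%:R * (n%:R * (e * M)) + n%:R * (M * e)).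
Proof.
move=> Gu G1 BM.
have -> : G *m B *m G^t* - B =
    (G - 1%:M) *m B *m G^t* + B *m (G - 1%:M)^t*.
  by rewrite adjmxB adjmx1 mulmxBr !mulmxBl mulmx1 mul1mx addrA subrK.
have := mxleM (mxleM G1 BM) (mxle_adj (mxle_unitary Gu)).
rewrite mulr1 => h; apply: mxleD h _.
by apply: mxleM => //; apply: mxle_adj.
Qed.

Lemma mxle_bounded m n (A : 'M[C]_(m, n)) : exists2 M, 0 < M & mxle A M.
Proof.
exists (1 + \sum_i \sum_j `|A i j|).
  by rewrite ltr_pwDl ?ltr01 ?sumr_ge0// => i _; rewrite sumr_ge0.
move=> i j; rewrite (bigD1 i)//= (bigD1 j)//=.
rewrite addrA addrCA -addrA lerDl !addr_ge0// ?sumr_ge0// => k _.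
by rewrite sumr_ge0.
Qed.

End Entrywise.

Section PlaneRotation.
Variables (C : numClosedFieldType) (n : nat).
Implicit Types (H : 'M[C]_n) (i j k l : 'I_n) (a b : C).

Definition plane_rot i j a b : 'M[C]_n :=
  \matrix_(k, l) if k == i then a *+ (l == i) + b *+ (l == j)
    else if k == j then (- b^*) *+ (l == i) + a^* *+ (l == j)
    else (k == l)%:R.

Lemma sum_pick2 (F : 'I_n -> C) i j a b :
  \sum_l (a *+ (l == i) + b *+ (l == j)) * F l = a * F i + b * F j.
Proof.
have pick1 c m : \sum_l (c *+ (l == m)) * F l = c * F m.
  rewrite (bigD1 m)//= eqxx big1 ?addr0// => l /negPf->.
  by rewrite mul0r.
by rewrite (eq_bigr _ (fun l _ => mulrDl _ _ _)) big_split/= !pick1.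
Qed.

Lemma plane_rot_mulE i j a b H k l :
  (plane_rot i j a b *m H) k l =
    if k == i then a * H i l + b * H j l
    else if k == j then (- b^*) * H i l + a^* * H j l else H k l.
Proof.
rewrite mxE; under eq_bigr do rewrite mxE.
case: (k == i); first exact: (sum_pick2 (H^~ l)).
case: (k == j); first exact: (sum_pick2 (H^~ l)).
rewrite (bigD1 k)//= eqxx mul1r big1 ?addr0// => m.
by rewrite eq_sym => /negPf->; rewrite mul0r.
Qed.

Lemma mul_plane_rotE i j a b H k l :
  (H *m (plane_rot i j a b)^t*) k l =
    if l == i then a^* * H k i + b^* * H k j
    else if l == j then - b * H k i + a * H k j else H k l.
Proof.
rewrite -[H in LHS]trmxCK -adjmxM mxE mxE plane_rot_mulE !mxE.
case: (l == i); first by rewrite rmorphD !rmorphM /= !conjCK.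
by case: (l == j); rewrite ?rmorphD ?rmorphM ?rmorphN/= !conjCK.
Qed.

Lemma plane_rot_unitary i j a b : i != j -> `|a| ^+ 2 + `|b| ^+ 2 = 1 ->
  plane_rot i j a b \is unitarymx.
Proof.
move=> ij; rewrite !normCK => ab1; apply/unitarymxP/matrixP => k l.
have ji : (j == i) = false by rewrite eq_sym (negPf ij).
rewrite plane_rot_mulE !mxE !eqxx !ji !(negPf ij).
have [ki|ki] := eqVneq k i.
  have [li|li] := eqVneq l i.
    rewrite ki li eqxx !(mulr1n, mulr0n) addr0 add0r.
    by rewrite -ab1.
  have [lj|lj] := eqVneq l j.
    rewrite ki lj (negPf ij) !(mulr1n, mulr0n) addr0 add0r !rmorphN /= !conjCK.
    by ring.
  by rewrite ki eq_sym (negPf li) !rmorph0 !mulr0 addr0.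
have [kj|kj] := eqVneq k j.
  have [li|li] := eqVneq l i.
    by rewrite kj li ji !(mulr1n, mulr0n) addr0 add0r; ring.
  have [lj|lj] := eqVneq l j.
    rewrite kj lj eqxx !(mulr1n, mulr0n) addr0 add0r !rmorphN /= !conjCK -ab1.
    by ring.
  by rewrite kj eq_sym (negPf lj) !rmorph0 !mulr0 addr0.
have [li|li] := eqVneq l i.
  by rewrite li (negPf ki) !mulr0n addr0 rmorph0.
have [lj|lj] := eqVneq l j.
  by rewrite lj (negPf kj) !mulr0n addr0 rmorph0.
by rewrite eq_sym conjC_nat.
Qed.

Lemma plane_rot_near1 i j (c s u : C) : i != j -> c \is Num.real ->
  `|u| = 1 -> mxle (plane_rot i j c (s * u) - 1%:M) (`|c - 1| + `|s|).
Proof.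
move=> ij cr u1 k l; rewrite !mxE.
have ge0 : 0 <= `|c - 1| + `|s| by rewrite addr_ge0.
have ji : (j == i) = false by rewrite eq_sym (negPf ij).
have [->|ki] := eqVneq k i.
  have [->|li] := eqVneq l i.
    by rewrite (negPf ij) ?eqxx/= !(mulr1n, mulr0n) addr0 lerDl.
  rewrite mulr0n add0r subr0.
  have [_|lj] := eqVneq l j; last by rewrite mulr0n normr0.
  by rewrite mulr1n normrM u1 mulr1 lerDr.
have [->|kj] := eqVneq k j.
  have [->|li] := eqVneq l i.
    rewrite ji (negPf ij) mulr1n mulr0n addr0 subr0 normrN norm_conjC normrM.
    by rewrite u1 mulr1 lerDr.
  rewrite mulr0n add0r.
  have [_|lj] := eqVneq l j; last by rewrite mulr0n subr0 normr0.
  by rewrite mulr1n (CrealP cr) lerDl.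
by rewrite subrr normr0.
Qed.

(** The trace of the 2x2 block is preserved, so [i] gains what [j] loses. The phase [u] is free and
    decides how the off-diagonal entries contribute. *)
Lemma plane_rot_diag i j (c s u : C) H : i != j ->
  c \is Num.real -> s \is Num.real -> `|u| = 1 -> c ^+ 2 + s ^+ 2 = 1 ->
  exists G : 'M[C]_n, [/\ G \is unitarymx,
    mxle (G - 1%:M) (`|c - 1| + `|s|) &
    forall k, (G *m H *m G^t*) k k = H k k +
      (s ^+ 2 * (H j j - H i i) + c * s * (u * H j i + u^* * H i j)) *
      ((k == i)%:R - (k == j)%:R)].
Proof.
move=> ij cr sr u1 cs1; exists (plane_rot i j c (s * u)).
have uu : u * u^* = 1 by rewrite -normCK u1 expr1n.
have ji : (j == i) = false by rewrite eq_sym (negPf ij).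
split; last move=> k.
- by apply: plane_rot_unitary => //; rewrite normrM u1 mulr1 !real_normK.
- exact: plane_rot_near1.
rewrite mul_plane_rotE !plane_rot_mulE.
have [->|ki] := eqVneq k i.
  rewrite (negPf ij) /= subr0 mulr1 !rmorphM/= (CrealP cr) (CrealP sr).
  have -> : c * (c * H i i + s * u * H j i) + s * u^* * (c * H i j + s * u * H j j)
    = c ^+ 2 * H i i + s ^+ 2 * (u * u^*) * H j j
      + c * s * (u * H j i + u^* * H i j) by ring.
  have -> : c ^+ 2 = 1 - s ^+ 2 by rewrite -cs1 addrK.
  by rewrite uu; ring.
have [->|kj] := eqVneq k j.
  rewrite sub0r !rmorphM/= (CrealP cr) (CrealP sr).
  have -> : - (s * u) * (- (s * u^*) * H i i + c * H j i)
      + c * (- (s * u^*) * H i j + c * H j j)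
    = s ^+ 2 * (u * u^*) * H i i + c ^+ 2 * H j j
      - c * s * (u * H j i + u^* * H i j) by ring.
  have -> : c ^+ 2 = 1 - s ^+ 2 by rewrite -cs1 addrK.
  by rewrite uu; ring.
by rewrite subrr mulr0 addr0.
Qed.

End PlaneRotation.

(** * Transfers between two diagonal entries *)

Section Transfer.
Variables (C : numClosedFieldType) (n : nat).
Implicit Types (A B H : 'M[C]_n) (i j k l : 'I_n).

Lemma hermE H i j : H^t* = H -> H j i = (H i j)^*.
Proof. by move=> /matrixP/(_ j i); rewrite !mxE. Qed.

Lemma herm_diag_real H i : H^t* = H -> H i i \is Num.real.
Proof. by move=> Hh; apply/CrealP; rewrite -hermE. Qed.

Lemma herm_conjmx (U H : 'M[C]_n) :
  H^t* = H -> (U *m H *m U^t*)^t* = U *m H *m U^t*.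
Proof. by move=> Hh; rewrite !adjmxM Hh trmxCK mulmxA. Qed.

Lemma phase_exists (z : C) : exists2 u, `|u| = 1 & u * z^* = `|z|.
Proof.
have [->|z0] := eqVneq z 0; first by exists 1; rewrite ?normr1// conjC0 mulr0 normr0.
exists (z / `|z|); first by rewrite normrM normfV normr_id divff ?normr_eq0.
by rewrite mulrAC -normCK expr2 mulfK// normr_eq0.
Qed.

(** A rotation with squared sine [t / D] realizes any amount up to the gap [D]. It need not be close
    to the identity; this is the elementary move of the Schur-Horn theorem. *)
Lemma herm_transfer H i j t : H^t* = H -> i != j ->
  0 <= t -> t <= H j j - H i i ->
  exists2 G : 'M[C]_n, G \is unitarymx & forall k,
    (G *m H *m G^t*) k k = H k k + t * ((k == i)%:R - (k == j)%:R).
Proof.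
move=> Hh ij t0 tD; set D := H j j - H i i in tD *.
have [->|tn0] := eqVneq t 0.
  exists 1%:M; first exact: unitarymx1.
  by move=> k; rewrite adjmx1 mulmx1 mul1mx mul0r addr0.
have D0 : 0 < D by apply: lt_le_trans tD; rewrite lt_def tn0.
have r0 : 0 <= t / D by rewrite divr_ge0 // ltW.
have r1 : 0 <= 1 - t / D by rewrite subr_ge0 ler_pdivrMr ?mul1r.
(* The phase ['i * u0] kills the contribution of [H i j], so that the new
   diagonal entries are convex combinations of the old ones. *)
have [u0 u01 u0z] := phase_exists (H i j).
have ui : `|'i * u0| = 1 by rewrite normrM normCi u01 mul1r.
have /= [] := @plane_rot_diag C n i j (sqrtC (1 - t / D)) (sqrtC (t / D))
  ('i * u0) H ij _ _ ui.
- by rewrite ger0_real ?sqrtC_ge0.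
- by rewrite ger0_real ?sqrtC_ge0.
- by rewrite !sqrtCK subrK.
move=> G [Gu _ Gd]; exists G => // k; rewrite Gd; congr (_ + _ * _).
rewrite sqrtCK divfK ?gt_eqF// (hermE i j Hh).
have -> : 'i * u0 * (H i j)^* + ('i * u0)^* * H i j = 0.
  have u0z' : u0^* * H i j = `|H i j|.
    by have := congr1 Num.conj_op u0z; rewrite rmorphM/= conjCK conj_normC.
  by rewrite rmorphM /= conjCi -!mulrA u0z u0z' mulNr subrr.
by rewrite mulr0 addr0.
Qed.

(** Merges finitely many tolerances into one: [a * c / (a + c)] lies below both [a] and [c] without
    comparing them. *)
Lemma exists_pos_le (F : numFieldType) (s : seq F) : all (> 0) s ->
  exists2 c, 0 < c & all (>= c) s.
Proof.
elim: s => [_|a s IH /= /andP[a0 /IH[c c0 cs]]]; first by exists 1.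
have ac0 : 0 < a + c by rewrite addr_gt0.
exists (a * c / (a + c)); first by rewrite divr_gt0// mulr_gt0.
apply/andP; split.
  by rewrite ler_pdivrMr// ler_pM2l// lerDr ltW.
apply: sub_all cs => x /=; apply: le_trans.
by rewrite ler_pdivrMr// mulrC ler_pM2l// lerDl ltW.
Qed.

(** Small real amounts can be moved from entry [j] to entry [i] without leaving a neighbourhood of
    [A]. Quantifying over all [B] near [A], instead of [A] alone, is what makes transfers
    composable. *)
Definition transferable A i j := forall e : C, 0 < e -> exists2 dl : C, 0 < dl &
  forall B t, B^t* = B -> mxle (B - A) dl -> t \is Num.real -> `|t| <= dl ->
  exists V : 'M[C]_n, [/\ V \is unitarymx, mxle (V *m B *m V^t* - A) e &
    forall k, (V *m B *m V^t*) k k = B k k + t * ((k == i)%:R - (k == j)%:R)].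

Lemma transferable_refl A i : transferable A i i.
Proof.
move=> e e0; exists e => // B t Bh BA _ _; exists 1%:M.
rewrite adjmx1 mulmx1 mul1mx; split=> //; first exact: unitarymx1.
by move=> k; rewrite subrr mulr0 addr0.
Qed.

(** The same amount goes from [j] to [i] and then from [k] to [j], so entry [j] ends unchanged. The
    tolerance of the second transfer is the target precision of the first. *)
Lemma transferable_trans A i j k :
  transferable A i j -> transferable A j k -> transferable A i k.
Proof.
move=> ij jk e e0; have [d1 d10 P1] := jk e e0.
have [d2 d20 P2] := ij d1 d10.
have [|d d0 /=/and3P[dd1 dd2 _]] := @exists_pos_le C [:: d1; d2].
  by rewrite /= d10 d20.
exists d => // B t Bh BA tr td.
have [V [Vu VA Vd]] := P2 B t Bh (mxle_trans BA dd2) tr (le_trans td dd2).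
have [W [Wu WA Wd]] := P1 _ t (herm_conjmx V Bh) VA tr (le_trans td dd1).
exists (W *m V); rewrite adjmxM !mulmxA in WA Wd *; split=> //.
  exact: mul_unitarymx.
move=> l; rewrite -!mulmxA in Wd Vd *; rewrite Wd Vd -addrA; congr (_ + _).
by rewrite -mulrDr addrA subrK.
Qed.

(** Since [p * t = (r - q) * (r + q)], this is the usual root [(r - q) / p] with its numerator
    rationalized, which also makes sense for [p = 0]. *)
Lemma quadratic_root (p q r t : C) : r ^+ 2 = q ^+ 2 + p * t -> q + r != 0 ->
  (t / (q + r)) ^+ 2 * p + 2 * q * (t / (q + r)) = t.
Proof.
move=> r2 qr0; have [->|t0] := eqVneq t 0; first by rewrite mul0r; ring.
apply: (mulfI t0); rewrite mulrDr mulrCA [t * p]mulrC.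
have -> : p * t = r ^+ 2 - q ^+ 2 by rewrite r2 addrAC subrr add0r.
by field.
Qed.

(** With a phase turning the off-diagonal contribution into [2 * q], where [q] is the modulus of
    [B i j], the transferred amount has a linear term in the angle. As [q] stays away from 0, a
    small amount needs only a small angle. *)
Lemma transferable_edge A i j : A^t* = A -> i != j -> A i j != 0 ->
  transferable A i j.
Proof.
move=> Ah ij Aij e e0; have [M M0 AM] := mxle_bounded A.
set q0 := `|A i j|; have q00 : 0 < q0 by rewrite normr_gt0.
pose N : C := n%:R; have N0 : 0 <= N by rewrite ler0n.
pose K := 4 * (N ^+ 2 + N) * (M + 1) / q0.
have M10 : 0 < M + 1 by rewrite addr_gt0.
have K0 : 0 <= K by rewrite divr_ge0 ?(ltW q00)// mulr_ge0 ?(ltW M10)// mulr_ge0// addr_ge0// exprn_ge0.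
have M30 : 0 < 2 * M + 3 by rewrite addr_gt0 ?mulr_gt0.
have K10 : 0 < K + 1 by rewrite ltr_wpDl.
(* In order, the bounds keep [B] and [t] bounded, keep [B i j] at least [q0 / 2] in modulus and the
   tangent at most 1, make the discriminant nonnegative, and give the final precision. *)
have [|d d0 /=/and5P[d1 dq dp de _]] :=
    @exists_pos_le C [:: 1; q0 / 2; q0 ^+ 2 / 4 / (2 * M + 3); e / (K + 1)].
  by rewrite /= ltr01 !divr_gt0 ?exprn_gt0.
exists d => // B t Bh BA tr td.
have Bij : q0 / 2 <= `|B i j|.
  have := BA i j; rewrite !mxE distrC => BAij.
  have := lerB_dist (A i j) (B i j); rewrite -/q0 => h.
  have := le_trans (le_trans h BAij) dq.
  rewrite lerBlDl -lerBlDr; apply: le_trans.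
  by rewrite [X in _ <= X - _](splitr q0) addrK.
set q := `|B i j| in Bij *.
have q20 : 0 < q0 / 2 by rewrite divr_gt0.
have qg0 : 0 < q by apply: lt_le_trans Bij.
have BM : mxle B (M + 1).
  move=> k l; rewrite -(subrK (A k l) (B k l)) (le_trans (ler_normD _ _))//.
  rewrite addrC lerD//; apply: le_trans d1.
  by have := BA k l; rewrite !mxE.
(* Subtracting [t] clears the factor [c ^+ 2 = 1 / (1 + T ^+ 2)]: the transferred amount is [t]
   exactly when [p T^2 + 2 q T = t]. *)
pose p := B j j - B i i - t.
have pr : p \is Num.real by rewrite !realB// herm_diag_real.
have pM : `|p| <= 2 * M + 3.
  have -> : 2 * M + 3 = M + 1 + (M + 1) + 1 by ring.
  rewrite (le_trans (ler_normB _ _))// lerD//; last exact: le_trans d1.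
  by rewrite (le_trans (ler_normB _ _))// lerD.
have pt : `|p * t| <= q ^+ 2.
  have : `|p * t| <= (2 * M + 3) * d by rewrite normrM ler_pM.
  move/le_trans; apply.
  rewrite mulrC -ler_pdivlMr// (le_trans dp)// ler_wpM2r ?invr_ge0 ?(ltW M30)//.
  have -> : q0 ^+ 2 / 4 = (q0 / 2) ^+ 2 by field.
  by rewrite ler_pXn2r// ?nnegrE (ltW q20, ltW qg0).
have r20 : 0 <= q ^+ 2 + p * t.
  have := pt; rewrite real_ler_norml ?realM// => /andP[+ _].
  by rewrite -subr_ge0 opprK addrC.
set r := sqrtC (q ^+ 2 + p * t).
have rg0 : 0 <= r by rewrite sqrtC_ge0.
have qr0 : 0 < q + r by rewrite ltr_pwDl.
(* [T], the tangent of the rotation angle, is a root of [p T^2 + 2 q T - t];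
   this form of the root is small with [t], whatever [p] is. *)
pose T := t / (q + r).
have Tr : T \is Num.real by rewrite realM ?realV ?(gtr0_real qr0).
have etaE : 2 * d / q0 = d / (q0 / 2) by field; rewrite gt_eqF.
have Td : `|T| <= 2 * d / q0.
  rewrite etaE normrM normfV (gtr0_norm qr0) ler_pdivrMr//.
  apply: le_trans td _; rewrite mulrAC ler_pdivlMr// ler_pM2l//.
  by rewrite (le_trans Bij)// lerDl.
have eta1 : 2 * d / q0 <= 1 by rewrite etaE ler_pdivrMr// mul1r.
have T1 : `|T| <= 1 by apply: le_trans eta1.
have T20 : 0 <= T ^+ 2 by rewrite real_exprn_even_ge0.
have T21 : 0 < 1 + T ^+ 2 by rewrite ltr_pwDl.
pose c := (sqrtC (1 + T ^+ 2))^-1.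
have c0 : 0 < c by rewrite invr_gt0 sqrtC_gt0.
have c2 : c ^+ 2 * (1 + T ^+ 2) = 1.
  by rewrite exprVn sqrtCK mulVf// gt_eqF.
have c1 : c ^+ 2 <= 1 by rewrite -c2 ler_peMr ?exprn_ge0 ?(ltW c0)// lerDl.
have c1' : c <= 1 by rewrite -(@expr_le1 _ 2)// ltW.
have cs : c ^+ 2 + (T * c) ^+ 2 = 1 by rewrite -[RHS]c2; ring.
have [u u1 uz] := phase_exists (B i j).
have [G [Gu G1 Gd]] := plane_rot_diag B ij (gtr0_real c0)
  (realM Tr (gtr0_real c0)) u1 cs.
have sT : `|T * c| <= `|T| by rewrite normrM (gtr0_norm c0) ler_piMr.
(* The chain is [1 - c <= 1 - c^2 = (T c)^2 <= |T|^2 <= |T|]. *)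
have cT : `|c - 1| <= `|T|.
  rewrite distrC ger0_norm ?subr_ge0//.
  apply: (@le_trans _ _ (1 - c ^+ 2)).
    by rewrite lerD2l lerN2 expr2 ler_piMr// ltW.
  rewrite -cs addrAC subrr add0r -(real_normK (realM Tr (gtr0_real c0))).
  apply: le_trans (_ : `|T| ^+ 2 <= _).
    by rewrite ler_pXn2r// nnegrE.
  by rewrite expr2 ler_piMr.
have G2 : mxle (G - 1%:M) (4 * d / q0).
  apply: mxle_trans G1 _.
  have -> : 4 * d / q0 = 2 * d / q0 + 2 * d / q0 by ring.
  by apply: lerD; [exact: le_trans cT Td | exact: le_trans sT Td].
exists G; split=> //.
  have := mxle_dist_trans (mxle_conjmx_near1 Gu G2 BM) BA.
  move=> h; apply: mxle_trans h _.
  have -> : n%:R * (n%:R * (4 * d / q0 * (M + 1))) +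
      n%:R * ((M + 1) * (4 * d / q0)) + d = d * (K + 1).
    by rewrite /K /N; ring.
  by rewrite -ler_pdivlMr.
move=> k; rewrite Gd; congr (_ + _ * _).
rewrite (hermE i j Bh).
have -> : u * (B i j)^* + u^* * B i j = 2 * q.
  have uz' : u^* * B i j = q.
    by have := congr1 Num.conj_op uz; rewrite rmorphM/= conjCK conj_normC.
  by rewrite uz uz' -/q; ring.
have TE : T ^+ 2 * p + 2 * q * T = t.
  by apply: quadratic_root; rewrite ?sqrtCK ?gt_eqF.
have -> : B j j - B i i = p + t by rewrite /p subrK.
have -> : (T * c) ^+ 2 * (p + t) + c * (T * c) * (2 * q) =
  c ^+ 2 * (T ^+ 2 * p + 2 * q * T + T ^+ 2 * t) by ring.
by rewrite TE -[RHS]mul1r -[in RHS]c2; ring.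
Qed.

End Transfer.

(** * Moving the diagonal inside irreducible blocks *)

Section Components.
Variables (C : numClosedFieldType) (n : nat).
Implicit Types (A B H X : 'M[C]_n) (i j k l : 'I_n).

(** For Hermitian [A], the connected components are the irreducible diagonal blocks, up to a
    simultaneous permutation of rows and columns. *)
Definition mxgraph A : rel 'I_n := [rel i j | A i j != 0].

Lemma mxgraph_connect_sym A : A^t* = A -> connect_sym (mxgraph A).
Proof.
move=> Ah; apply: sym_connect_sym => i j /=.
by rewrite /mxgraph /= (hermE j i Ah) conjC_eq0.
Qed.

Lemma connect_transferable A i j : A^t* = A -> connect (mxgraph A) i j ->
  transferable A i j.
Proof.
move=> Ah /connectP[p]; elim: p i => [|k p IH] i /=.
  by move=> _ ->; apply: transferable_refl.
move=> /andP[Aik kp] jp; apply: transferable_trans (IH k kp jp).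
(* A nonzero diagonal entry is a loop of the graph, a case outside [transferable_edge]. *)
have [->|ik] := eqVneq i k; first exact: transferable_refl.
exact: transferable_edge.
Qed.

(** Each entry of [s] that is not a representative is corrected against its representative [r i].
    This touches no other entry, and [r i] is itself a representative, so earlier corrections
    survive; both ends lie in one class, so class sums do not move. *)
Lemma transfer_seq A (r : 'I_n -> 'I_n) (s : seq 'I_n) :
  (forall i, transferable A i (r i)) -> (forall i, r (r i) = r i) ->
  forall e : C, 0 < e -> exists2 dl : C, 0 < dl &
  forall B, B^t* = B -> A^t* = A -> mxle (B - A) dl ->
  exists V : 'M[C]_n, [/\ V \is unitarymx, mxle (V *m B *m V^t* - A) e,
    forall i, i \in s -> r i != i -> (V *m B *m V^t*) i i = A i i &
    forall v, \sum_(k | r k == v) (V *m B *m V^t*) k k =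
              \sum_(k | r k == v) B k k].
Proof.
move=> Ar rr; elim: s => [|i s IH] e e0.
  exists e => // B Bh Ah BA; exists 1%:M; rewrite adjmx1 mulmx1 mul1mx.
  by split=> //; exact: unitarymx1.
have [ri|ri] := eqVneq (r i) i.
  have [d d0 P] := IH e e0; exists d => // B Bh Ah BA.
  have [V [Vu VA Vs Vv]] := P B Bh Ah BA; exists V; split=> // j.
  by rewrite inE => /predU1P[->|/Vs//]; rewrite ri eqxx.
have [d1 d10 P1] := Ar i e e0.
have [d d0 P] := IH d1 d10; exists d => // B Bh Ah BA.
have [V [Vu VA Vs Vv]] := P B Bh Ah BA.
pose t := A i i - (V *m B *m V^t*) i i.
have Vh := herm_conjmx V Bh.
have [||W [Wu WA Wd]] := P1 _ t Vh VA.
- by rewrite realB ?(herm_diag_real _ Ah) ?(herm_diag_real _ Vh).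
- by have := VA i i; rewrite mxE [X in _ + X]mxE distrC.
exists (W *m V); rewrite adjmxM !mulmxA in WA Wd *; split=> //.
- exact: mul_unitarymx.
- move=> j; rewrite inE Wd => js rj.
  have [ji|ji] := eqVneq j i.
    by rewrite ji eq_sym (negPf ri) subr0 mulr1 addrC subrK.
  rewrite (negPf ji) /= in js.
  have -> : (j == r i) = false by apply: contraNF rj => /eqP->; rewrite rr.
  by rewrite subrr mulr0 addr0 Vs.
move=> v; rewrite -Vv (eq_bigr _ (fun k _ => Wd k)) big_split/=.
rewrite -mulr_sumr sumrB.
have pick j : \sum_(k | r k == v) (k == j)%:R = (r j == v)%:R :> C.
  rewrite big_mkcond (bigD1 j)//= eqxx big1 ?addr0; first by case: (_ == _).
  by move=> k /negPf->; rewrite if_same.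
by rewrite !pick rr subrr mulr0 addr0.
Qed.

(** Transfers to the roots make all non-root entries exact; since the block sums of [B] and [A]
    agree, the root entries are then exact as well. *)
Lemma correct_diag A : A^t* = A ->
  forall e : C, 0 < e -> exists2 dl : C, 0 < dl &
  forall B, B^t* = B -> mxle (B - A) dl ->
    (forall v, \sum_(k | fingraph.root (mxgraph A) k == v) B k k =
               \sum_(k | fingraph.root (mxgraph A) k == v) A k k) ->
  exists V : 'M[C]_n, [/\ V \is unitarymx, mxle (V *m B *m V^t* - A) e &
    forall i, (V *m B *m V^t*) i i = A i i].
Proof.
move=> Ah e e0; have sym := mxgraph_connect_sym Ah.
have Ar i : transferable A i (fingraph.root (mxgraph A) i).
  by apply: connect_transferable => //; apply: connect_root.
have [d d0 P] := transfer_seq (enum 'I_n) Ar (root_root sym) e0.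
exists d => // B Bh BA Bsum.
have [V [Vu VA Vs Vv]] := P B Bh Ah BA; exists V; split=> // i.
have [ri|ri] := eqVneq (fingraph.root (mxgraph A) i) i; last by rewrite Vs ?mem_enum.
have := Vv i; rewrite Bsum (bigD1 i) ?ri//= [in RHS](bigD1 i) ?ri//=.
rewrite (eq_bigr (fun k => A k k)); first by move/addIr.
move=> k /andP[/eqP rk ki]; apply: Vs; rewrite ?mem_enum// rk eq_sym//.
Qed.

(** The diagonal matrix [W] of block labels commutes with [A], so both can be diagonalized together.
    Row [k] of [V] is then supported on the single block labelled [w k], and a block sum of the
    diagonal is a trace over the rows of that block. *)
Lemma adapted_eigenbasis A (r : 'I_n -> nat) : A^t* = A ->
  (forall i j, A i j != 0 -> r i = r j) ->
  exists (V : 'M[C]_n) (lam : 'rV[C]_n) (w : 'I_n -> C),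
  [/\ V \is unitarymx, V *m A *m V^t* = diag_mx lam &
    forall X v, \sum_(i | r i == v) (V^t* *m X *m V) i i =
                \sum_(k | w k == v%:R) X k k].
Proof.
move=> Ah Ar.
pose W : 'M[C]_n := diag_mx (\row_i (r i)%:R).
have Wh : W^t* = W.
  apply/matrixP => i j; rewrite !mxE rmorphMn/= conjC_nat.
  by rewrite eq_sym; case: eqP => // ->.
have AW : A *m W = W *m A.
  apply/matrixP => i j; rewrite mul_mx_diag mul_diag_mx !mxE mulrC.
  have [->|/Ar->//] := eqVneq (A i j) 0; by rewrite !mulr0.
(* The normal matrix [A + i W] diagonalizes [A] and [W] simultaneously. *)
pose N := A + 'i *: W.
have Nh : N^t* = A - 'i *: W.
  by rewrite linearD map_mxD/= linearZ map_mxZ/= conjCi Ah Wh scaleNr.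
have Nn : N \is normalmx.
  apply/normalmxP; rewrite Nh !mulmxDl !mulmxDr -!scalemxAl !mulmxN -!scalemxAr.
  rewrite !mulNmx -!scalemxAl AW -!addrA; congr (_ + _).
  by rewrite [in RHS]addrC -!addrA; congr (_ + _); rewrite addrC.
have Ndec := orthomx_spectralP Nn.
set V := spectralmx N in Ndec; set D := spectral_diag N in Ndec.
have Vu : V \is unitarymx by apply: spectral_unitarymx.
rewrite (invmx_unitary Vu) in Ndec.
have VN : V *m N *m V^t* = diag_mx D.
  by rewrite Ndec !mulmxA (unitarymxP Vu) mul1mx -mulmxA (unitarymxP Vu) mulmx1.
have VN' : V *m N^t* *m V^t* = diag_mx (map_mx Num.conj_op D).
  have := congr1 (fun X : 'M[C]_n => X^t*) VN.
  by rewrite !adjmxM trmxCK tr_diag_mx map_diag_mx mulmxA.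
have i2 : 'i != 0 :> C by apply: neq0Ci.
have two0 : 2 != 0 :> C by rewrite pnatr_eq0.
have AN : A = 2^-1 *: (N + N^t*).
  rewrite Nh /N addrACA subrr addr0 scalerDr -scalerDl -mulr2n.
  by rewrite -[_ *+ 2]mulr_natr mulVf// scale1r.
have WN : W = (2 * 'i)^-1 *: (N - N^t*).
  rewrite Nh opprB /N addrC addrA subrK -scalerDl scalerA.
  by rewrite -mulr2n -['i *+ 2]mulr_natl mulVf ?scale1r// mulf_neq0.
pose w k := (2 * 'i)^-1 * (D 0 k - (D 0 k)^*).
have VW : V *m W *m V^t* = diag_mx (\row_k w k).
  rewrite WN -scalemxAr -scalemxAl mulmxBr mulmxBl VN VN'.
  by rewrite -linearB -linearZ; congr diag_mx; apply/rowP => k; rewrite !mxE.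
have VWe k i : V k i != 0 -> w k = (r i)%:R.
  move=> Vki; have : V *m W = diag_mx (\row_k w k) *m V.
    by rewrite -VW -[RHS]mulmxA (unitarymxK Vu) mulmx1.
  move=> /matrixP/(_ k i); rewrite mul_mx_diag mul_diag_mx !mxE mulrC.
  by move/(mulIf Vki).
exists V, (2^-1 *: (D + map_mx Num.conj_op D)), w; split=> //.
  rewrite AN -scalemxAr -scalemxAl mulmxDr mulmxDl VN VN'.
  by rewrite -linearD -linearZ.
move=> X v.
have entry i : (V^t* *m X *m V) i i = \sum_k \sum_l X k l * (V l i * (V k i)^*).
  rewrite mxE; under eq_bigr do rewrite mxE mulr_suml.
  rewrite exchange_big; apply: eq_bigr => k _; apply: eq_bigr => l _.
  by rewrite !mxE; ring.
rewrite (eq_bigr _ (fun i _ => entry i)) exchange_big [RHS]big_mkcond/=.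
apply: eq_bigr => k _; rewrite exchange_big/=.
under eq_bigr do rewrite -mulr_sumr.
(* Because row [k] is supported on one block, the restricted sum is either the full inner product of
   rows [l] and [k] or zero. *)
have sumV l : \sum_(i | r i == v) V l i * (V k i)^* =
    ((w k == v%:R) && (l == k))%:R.
  have -> : \sum_(i | r i == v) V l i * (V k i)^* =
      (w k == v%:R)%:R * \sum_i V l i * (V k i)^*.
    rewrite big_mkcond mulr_sumr; apply: eq_bigr => i _.
    have [->|/VWe->] := eqVneq (V k i) 0.
      by rewrite conjC0 !mulr0 if_same.
    rewrite eqr_nat; by case: eqP; rewrite ?mul1r ?mul0r.
  have -> : \sum_i V l i * (V k i)^* = (l == k)%:R.
    have := congr1 (fun Y : 'M[C]_n => Y l k) (unitarymxP Vu).
    by rewrite !mxE => <-; apply: eq_bigr => i _; rewrite !mxE.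
  by case: (w k == _); rewrite ?mul1r ?mul0r.
rewrite (eq_bigr _ (fun l _ => congr1 (fun z => X k l * z) (sumV l))).
case: (w k == v%:R) => /=; last by rewrite big1// => l _; rewrite mulr0.
rewrite (bigD1 k)//= eqxx mulr1 big1 ?addr0// => l /negPf->.
by rewrite mulr0.
Qed.

End Components.

Local Open Scope complex_scope.
Local Open Scope sesquilinear_scope.

(** * The Schur-Horn theorem *)

Section Majorization.
Variables (R : realType) (n : nat).
Implicit Types (x y h d : 'rV[R]_n) (i j : 'I_n).

Definition low_sum x (k : nat) : R := \sum_(i < n | (i < k)%N) x 0 i.

Lemma sort_up_perm x : exists s : {perm 'I_n}, forall i, sort_up x 0 i = x 0 (s i).
Proof.
have sz : size (sort <=%R [seq x 0 j | j <- enum 'I_n]) = n.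
  by rewrite size_sort size_map size_enum_ord.
pose t := Tuple (introT eqP sz); pose u := [tuple x 0 j | j < n].
have /tuple_permP[s st] : perm_eq t u by rewrite perm_sort -val_ord_tuple; exact: perm_refl.
exists s => i; rewrite mxE [sort _ _]st -tnth_nth tnth_mktuple.
by rewrite tnth_mktuple.
Qed.

Lemma sort_up_le x i j : (i <= j)%N -> sort_up x 0 i <= sort_up x 0 j.
Proof.
move=> ij; rewrite !mxE.
have sz : size (sort <=%R [seq x 0 j | j <- enum 'I_n]) = n.
  by rewrite size_sort size_map size_enum_ord.
apply: sorted_leq_nth => //; rewrite ?inE ?sz //.
  exact: le_trans.
exact: sort_le_sorted.
Qed.

Lemma low_sum_full x : low_sum x n = \sum_i x 0 i.
Proof. by apply: eq_bigl => i; rewrite ltn_ord. Qed.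

Lemma sort_up_sum x : low_sum (sort_up x) n = \sum_i x 0 i.
Proof.
have [s xs] := sort_up_perm x.
rewrite low_sum_full [RHS](reindex_inj (@perm_inj _ s)).
by apply: eq_bigr => i _; rewrite xs.
Qed.

(** The inequalities of [majorized] cover [1 <= k <= n - 1]; for [k = 0] the sums are empty, and for
    [k = n] the totals agree. *)
Lemma majorized_low_sum x y k : majorized x y -> (k <= n)%N ->
  low_sum (sort_up x) k <= low_sum (sort_up y) k.
Proof.
move=> [xy xyn]; case: k => [_|k kn]; first by rewrite /low_sum !big_pred0.
have [kn'|] := leqP k.+1 n.-1; first by apply: xy.
move=> nk; have -> : k.+1 = n by lia.
by rewrite !low_sum_full xyn.
Qed.

Lemma majorized_sum x y : majorized x y -> \sum_i x 0 i = \sum_i y 0 i.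
Proof. by case=> _ e; rewrite -!sort_up_sum !low_sum_full. Qed.

Lemma sum_indicator (k : nat) : (k <= n)%N ->
  \sum_(i < n) (i < k)%:R = k%:R :> R.
Proof.
move=> kn; rewrite -natr_sum -big_mkcond/=.
by rewrite -(big_ord_widen n (fun=> 1%N))// sum1_card card_ord.
Qed.

(** Both families of weights have total [k], so [x] may be shifted by a threshold [tau]; every term
    of the difference is then a product of two factors of the same sign. *)
Lemma low_sum_le_weighted x (c : 'I_n -> R) k : (k <= n)%N ->
  (forall i, 0 <= c i <= 1) -> \sum_i c i = k%:R ->
  low_sum (sort_up x) k <= \sum_i c i * x 0 i.
Proof.
move=> kn c01 ck; have [s xs] := sort_up_perm x.
(* [tau] separates the [k] smallest entries from the others. For [k = n] there are no others and any
   upper bound serves. *)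
have [tau lo hi] : exists2 tau, forall i, (i < k)%N -> sort_up x 0 i <= tau &
    forall i, (k <= i)%N -> tau <= sort_up x 0 i.
  move: kn; rewrite leq_eqVlt => /predU1P[->|kn].
    exists (\sum_i `|sort_up x 0 i|); last by move=> i; rewrite leqNgt ltn_ord.
    move=> i _; rewrite (bigD1 i)//= (le_trans (ler_norm _))// lerDl.
    by rewrite sumr_ge0.
  by exists (sort_up x 0 (Ordinal kn)) => i ik; apply: sort_up_le => //=; apply: ltnW.
rewrite (reindex_inj (@perm_inj _ s))/= -subr_ge0.
have cs : \sum_i c (s i) = k%:R by rewrite -ck [RHS](reindex_inj (@perm_inj _ s)).
have -> : \sum_i c (s i) * x 0 (s i) - low_sum (sort_up x) k =
    \sum_i (c (s i) - (i < k)%:R) * (sort_up x 0 i - tau).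
  transitivity (\sum_i (c (s i) - (i < k)%:R) * sort_up x 0 i
     - \sum_i (c (s i) - (i < k)%:R) * tau); last first.
    by rewrite -sumrB; apply: eq_bigr => i _; rewrite mulrBr.
  have -> : \sum_i (c (s i) - (i < k)%:R) * tau = 0.
    by rewrite -mulr_suml sumrB cs sum_indicator// subrr mul0r.
  rewrite subr0.
  rewrite /low_sum [X in _ - X]big_mkcond -sumrB; apply: eq_bigr => i _.
  by rewrite -xs mulrBl; case: ifP; rewrite ?mul1r ?mul0r.
apply: sumr_ge0 => i _; have /andP[c0 c1] := c01 (s i).
case: (ltnP i k) => ik.
  by rewrite mulr_le0// subr_le0 ?c1 ?lo.
by rewrite mulr_ge0// subr_ge0 ?hi.
Qed.

Lemma low_sum_le_perm x (s : {perm 'I_n}) k : (k <= n)%N ->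
  low_sum (sort_up x) k <= \sum_(i < n | (i < k)%N) x 0 (s i).
Proof.
move=> kn; pose c i : R := ((s^-1)%g i < k)%:R.
have := @low_sum_le_weighted x c k kn; rewrite [in X in _ -> X -> _](reindex_inj (@perm_inj _ s)).
rewrite [in X in _ -> _ -> X](reindex_inj (@perm_inj _ s)).
have -> : \sum_i c (s i) = k%:R.
  by rewrite -[RHS]sum_indicator//; apply: eq_bigr => i _; rewrite /c permK.
have -> : \sum_i c (s i) * x 0 (s i) = \sum_(i < n | (i < k)%N) x 0 (s i).
  rewrite [RHS]big_mkcond; apply: eq_bigr => i _; rewrite /c permK.
  by case: ltnP; rewrite ?mul1r ?mul0r.
by apply=> // i; rewrite /c; case: (_ < _)%N; rewrite ?lexx ?ler01.
Qed.

(** The Hardy-Littlewood-Polya argument as an induction principle: finitely many transfers lead from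
    [h] to [x], each lowering the number of positions where they differ. Only the target is sorted,
    since transfers may destroy the order of [h]. *)
Lemma majorization_ind (P : 'rV[R]_n -> Prop) :
  (forall h h' i j t, P h -> i != j -> 0 <= t -> t <= h 0 j - h 0 i ->
    (forall k, h' 0 k = h 0 k + t * ((k == i)%:R - (k == j)%:R)) -> P h') ->
  forall x h, (forall i j, (i <= j)%N -> x 0 i <= x 0 j) ->
  (forall k, (k <= n)%N -> low_sum h k <= low_sum x k) ->
  \sum_i h 0 i = \sum_i x 0 i -> P h -> P x.
Proof.
move=> Pt x h xs; have [m] := ubnP #|[pred i | h 0 i != x 0 i]|.
elim: m h => // m IH h; rewrite ltnS => hm hx hxs Ph.
have [j0 hj0|/(_ _)hlex] := pickP [pred j | h 0 j > x 0 j]; last first.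
  suff -> : x = h by [].
  apply/rowP => i; apply/eqP; rewrite eq_sym; apply/eqP.
  have hle k : h 0 k <= x 0 k by rewrite leNgt; have /= -> := hlex k.
  apply/eqP; rewrite eq_le hle /=.
  have := hxs; rewrite (bigD1 i)//= [in RHS](bigD1 i)//= => e.
  have : \sum_(k | k != i) h 0 k <= \sum_(k | k != i) x 0 k by apply: ler_sum.
  by move: e; lra.
(* Take the first [j] with [h j > x j]; some [i < j] has [h i < x i], and
   transferring as much as possible from [j] to [i] settles one of the two. *)
have [j hj jmin] := @arg_minnP _ j0 (fun j => h 0 j > x 0 j) (@nat_of_ord n) hj0.
have hle (k : 'I_n) : (k < j)%N -> h 0 k <= x 0 k.
  by move=> kj; rewrite leNgt; apply/negP => /jmin; rewrite leqNgt kj.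
have low_sumS y : low_sum y j.+1 = low_sum y j + y 0 j.
  rewrite /low_sum (bigD1 j)//= addrC; congr (_ + _); apply: eq_bigl => k.
  by rewrite ltnS ltn_neqAle andbC.
have [i /andP[ij hi]] : exists i, (i < j)%N && (h 0 i < x 0 i).
  apply/existsP; apply: contraT; rewrite negb_exists => /forallP no.
  have := hx j.+1 (ltn_ord j); rewrite !low_sumS leNgt ler_ltD//.
  by apply: ler_sum => k kj; move: (no k); rewrite kj/= -leNgt.
have ij' : i != j by apply: contraTneq ij => ->; rewrite ltnn.
pose t := Num.min (x 0 i - h 0 i) (h 0 j - x 0 j).
have t1 : t <= x 0 i - h 0 i by rewrite ge_min lexx.
have t2 : t <= h 0 j - x 0 j by rewrite ge_min lexx orbT.
have t0 : 0 < t by rewrite lt_min !subr_gt0 hi hj.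
have xij := xs i j (ltnW ij).
pose h' : 'rV[R]_n := \row_k (h 0 k + t * ((k == i)%:R - (k == j)%:R)).
have h'i : h' 0 i = h 0 i + t by rewrite mxE eqxx (negPf ij') subr0 mulr1.
have h'j : h' 0 j = h 0 j - t.
  by rewrite mxE eqxx eq_sym (negPf ij') sub0r mulrN1.
have h'k k : k != i -> k != j -> h' 0 k = h 0 k.
  by move=> /negPf ki /negPf kj; rewrite mxE ki kj subrr mulr0 addr0.
apply: (IH h').
- apply: leq_trans hm; apply: proper_card; apply/properP; split.
    apply/fintype.subsetP => k; rewrite !inE.
    have [->|ki] := eqVneq k i; first by rewrite (lt_eqF hi).
    have [->|kj] := eqVneq k j; first by rewrite (gt_eqF hj).
    by rewrite h'k.
  move: (minEle (x 0 i - h 0 i) (h 0 j - x 0 j)); rewrite -/t; case: ifP => _ tE.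
    by exists i; rewrite !inE ?(lt_eqF hi)// h'i tE addrC subrK eqxx.
  by exists j; rewrite !inE ?(gt_eqF hj)// h'j tE opprB addrC subrK eqxx.
(* Up to [j] the new vector lies entrywise below [x]; beyond [j] the partial sum contains both ends
   of the transfer and is unchanged. *)
- move=> k kn; have [kj|jk] := leqP k j.
    apply: ler_sum => l lk; have lj : (l < j)%N by apply: leq_trans kj.
    have [->|li] := eqVneq l i; first by rewrite h'i; lra.
    have [lj'|lj'] := eqVneq l j; first by rewrite lj' ltnn in lj.
    by rewrite h'k// hle.
  suff -> : low_sum h' k = low_sum h k by apply: hx.
  rewrite /low_sum (bigD1 i) ?(ltn_trans ij)//= (bigD1 j) 1?eq_sym ?jk//=.
  rewrite [in RHS](bigD1 i) ?(ltn_trans ij)//= [in RHS](bigD1 j) 1?eq_sym ?jk//=.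
  rewrite (eq_bigr (fun k => h 0 k)) ?h'i ?h'j; first by ring.
  by move=> l /andP[/andP[_ li] lj]; rewrite h'k.
- rewrite -hxs (bigD1 i)//= (bigD1 j) 1?eq_sym//=.
  rewrite [in RHS](bigD1 i)//= [in RHS](bigD1 j) 1?eq_sym//=.
  rewrite (eq_bigr (fun k => h 0 k)) ?h'i ?h'j; first by ring.
  by move=> l /andP[li lj]; rewrite h'k.
- apply: (Pt h h' i j t) => //; first exact: ltW.
    by lra.
  by move=> k; rewrite mxE.
Qed.

End Majorization.

(** * Spectra of conjugated and diagonal matrices *)

Section Spectrum.
Variables (C : numClosedFieldType) (n : nat).

Lemma char_poly_conjmx (U A : 'M[C]_n) : U \is unitarymx ->
  char_poly (U *m A *m U^t*) = char_poly A.
Proof.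
move=> /unitarymxP UU; rewrite /char_poly.
have -> : char_poly_mx (U *m A *m U^t*) =
    map_mx polyC U *m char_poly_mx A *m map_mx polyC (U^t*).
  rewrite /char_poly_mx !map_mxM mulmxBr mulmxBl scalar_mxC -(mulmxA 'X%:M).
  by rewrite -(map_mxM _ U (U^t*)) UU map_mx1 mulmx1.
by rewrite !det_mulmx mulrAC -det_mulmx -(map_mxM _ U (U^t*)) UU map_mx1 det1 mul1r.
Qed.

Lemma mup_prod_XsubC (z : C) (s : seq C) :
  mup z (\prod_(a <- s) ('X - a%:P)) = count_mem z s.
Proof.
elim: s => [|a s IH]; first by rewrite big_nil mupNroot// root1.
rewrite big_cons mupM ?polyXsubC_eq0 ?monic_neq0 ?monic_prod_XsubC//.
by rewrite IH -['X - _]expr1 mup_XsubCX /=; case: (a == z).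
Qed.

(** Root multiplicities of the characteristic polynomial count occurrences on the diagonal. *)
Lemma diag_spectrum_perm (l m : 'rV[C]_n) :
  (forall z, mup z (char_poly (diag_mx l)) = mup z (char_poly (diag_mx m))) ->
  exists s : {perm 'I_n}, forall i, l 0 i = m 0 (s i).
Proof.
have cpE (v : 'rV[C]_n) :
    char_poly (diag_mx v) = \prod_(a <- [tuple v 0 i | i < n]) ('X - a%:P).
  rewrite char_poly_trig ?diag_mx_is_trig// big_tuple.
  by apply: eq_bigr => i _; rewrite tnth_mktuple mxE eqxx.
move=> lm; have /tuple_permP[s st] :
    perm_eq [tuple l 0 i | i < n] [tuple m 0 i | i < n].
  by rewrite /perm_eq; apply/allP => z _; apply/eqP; rewrite -!mup_prod_XsubC -!cpE lm.
exists s => i; have := congr1 (fun t => tnth t i) (val_inj st).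
by rewrite !tnth_mktuple.
Qed.

Lemma conj_spectrum_perm (X V : 'M[C]_n) (l m : 'rV[C]_n) : V \is unitarymx ->
  V *m X *m V^t* = diag_mx l ->
  (forall z, mup z (char_poly (diag_mx m)) = mup z (char_poly X)) ->
  exists s : {perm 'I_n}, forall i, l 0 i = m 0 (s i).
Proof.
move=> Vu VX mX; apply: diag_spectrum_perm => z.
by rewrite mX -VX (char_poly_conjmx X Vu).
Qed.

Lemma perm_mx_unitary (s : {perm 'I_n}) : (perm_mx s : 'M[C]_n) \is unitarymx.
Proof. by apply/unitarymxP; rewrite tr_perm_mx map_perm_mx -perm_mxM mulgV perm_mx1. Qed.

Lemma perm_conjmxE (s : {perm 'I_n}) (A : 'M[C]_n) i j :
  (perm_mx s *m A *m (perm_mx s)^t*) i j = A (s i) (s j).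
Proof.
rewrite tr_perm_mx map_perm_mx -col_permE -row_permE !mxE.
by [].
Qed.

End Spectrum.

(** * Existence of Schur-Horn unitaries and description of the fibers *)

Section SchurHornFiber.
Variables (R : realType) (n : nat).
Implicit Types (d h : 'rV[R]_n) (L : 'M[R]_n) (U V Q X : 'M[R[i]]_n).

Lemma conj_real_complex (x : R) : (x%:C)^*%R = x%:C :> R[i].
Proof. by apply/CrealP/complex_realP; exists x. Qed.

Lemma complexify_diag L : is_diag_mx L ->
  complexify L = diag_mx (complexify (diagv L)).
Proof.
move=> /is_diag_mxP Ld; apply/matrixP => i j; rewrite !mxE.
by have [->|/Ld->] := eqVneq i j; rewrite ?mulr1n ?mulr0n ?rmorph0.
Qed.

Lemma complexify_herm L : is_diag_mx L -> (complexify L)^t* = complexify L.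
Proof.
move=> /complexify_diag->; rewrite tr_diag_mx map_diag_mx; congr diag_mx.
by apply/rowP => i; rewrite !mxE; exact: conj_real_complex.
Qed.

Lemma unitary_conj_herm U L : is_diag_mx L ->
  (unitary_conj U L)^t* = unitary_conj U L.
Proof. by move=> /complexify_herm Lh; apply: herm_conjmx. Qed.

Lemma schur_horn_transfer L h h' i j t Q : is_diag_mx L ->
  is_schur_horn_unitary h L Q -> i != j -> 0 <= t -> t <= h 0 j - h 0 i ->
  (forall k, h' 0 k = h 0 k + t * ((k == i)%:R - (k == j)%:R)) ->
  exists Q', is_schur_horn_unitary h' L Q'.
Proof.
move=> Ld [Qu Qd] ij t0 th h'E.
have Hd k : unitary_conj Q L k k = (h 0 k)%:C.
  by move/rowP: Qd => /(_ k); rewrite !mxE.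
have [||G Gu Gd] := herm_transfer (t := t%:C) (unitary_conj_herm Q Ld) ij.
- by rewrite ler0c.
- by rewrite !Hd -rmorphB lecR.
exists (G *m Q); split; first exact: mul_unitarymx Gu Qu.
apply/rowP => k; rewrite mxE [RHS]mxE.
have := Gd k; rewrite /unitary_conj adjmxM !mulmxA => ->.
rewrite -/(unitary_conj Q L).
by rewrite Hd h'E rmorphD rmorphM rmorphB !rmorph_nat.
Qed.

(** Horn's half: the sorted diagonal of [L] is realized by a permutation matrix, and every transfer
    of [majorization_ind] by a rotation. *)
Lemma schur_horn_exists d L : Sd d L -> exists Q, is_schur_horn_unitary d L Q.
Proof.
move=> [Ld Lmaj]; have [s ds] := sort_up_perm d.
have [u Lu] := sort_up_perm (diagv L).
(* The induction runs on sorted vectors; [s^-1] puts the entries back in the order of [d]. *)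
pose P h := exists Q, is_schur_horn_unitary (col_perm s^-1%g h) L Q.
suff : P (sort_up d).
  rewrite /P; suff -> : col_perm s^-1%g (sort_up d) = d by [].
  by apply/rowP => i; rewrite mxE ds permKV.
apply: (@majorization_ind _ _ P _ _ (sort_up (diagv L))).
- move=> h h' i j t [Q QP] ij t0 th h'E.
  apply: (@schur_horn_transfer _ (col_perm s^-1%g h) _ (s i) (s j) t Q) => //.
  + by rewrite (inj_eq perm_inj).
  + by rewrite !mxE !permK.
  + by move=> k; rewrite !mxE h'E -!(canF_eq (permKV s)).
- by move=> i j; apply: sort_up_le.
- by move=> k kn; apply: majorized_low_sum.
- by rewrite -!low_sum_full !sort_up_sum; apply: majorized_sum.
exists (perm_mx (s^-1 * u)%g); split; first exact: perm_mx_unitary.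
by apply/rowP => i; rewrite mxE perm_conjmxE mxE [RHS]mxE [in RHS]mxE Lu [diagv _ _ _]mxE permM.
Qed.

(** Turns the class, defined by multiplicities, into a set of unitary conjugates. A Hermitian [X] in
    it is diagonalizable with the entries of [L] in some order, and the reordering is absorbed into
    the unitary. *)
Lemma schur_horn_mapP d L X : Sd d L ->
  schur_horn_map d L X <->
  exists2 U, is_schur_horn_unitary d L U & X = unitary_conj U L.
Proof.
move=> dL; have [Ld _] := dL; have [Q QP] := schur_horn_exists dL.
rewrite (schur_horn_mapE QP) /eqclass /same_eigenvalues.
have [Qu _] := QP; rewrite (char_poly_unitary_conj L Qu); split; last first.
  move=> [U [Uu Ud] ->]; split.
    by split; [exact: Ud | rewrite (unitary_conj_herm U Ld)].
  by move=> z; rewrite (char_poly_unitary_conj L Uu).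
move=> [[Xd Xh] Xe].
have Xn : X \is normalmx by apply/normalmxP; rewrite -Xh.
have [V [l [Vu Xdec]]] : exists (V : 'M[R[i]]_n) l,
    V \is unitarymx /\ X = V^t* *m diag_mx l *m V.
  exists (spectralmx X), (spectral_diag X); split; first exact: spectral_unitarymx.
  by rewrite -invmx_unitary ?spectral_unitarymx//; exact: orthomx_spectralP.
have V'u : V^t* \is unitarymx by rewrite trmxC_unitary.
have VX : V *m X *m V^t* = diag_mx l.
  by rewrite Xdec !mulmxA (unitarymxP Vu) mul1mx -mulmxA (unitarymxP Vu) mulmx1.
have [s ls] : exists s : {perm 'I_n}, forall i, l 0 i = complexify (diagv L) 0 (s i).
  apply: (conj_spectrum_perm Vu VX); rewrite -(complexify_diag Ld).
  exact: Xe.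
have XE : X = unitary_conj (V^t* *m perm_mx s) L.
  rewrite [LHS]Xdec /unitary_conj adjmxM trmxCK -!mulmxA; congr (_ *m _).
  rewrite !mulmxA; congr (_ *m _); apply/matrixP => i j.
  rewrite perm_conjmxE complexify_diag// !mxE (inj_eq perm_inj) ls !mxE.
  by [].
exists (V^t* *m perm_mx s); last exact: XE.
split; first exact: mul_unitarymx V'u (perm_mx_unitary _ s).
by rewrite -XE; exact: Xd.
Qed.

End SchurHornFiber.

(** * Perturbation of the spectrum *)

Section Perturbation.
Variables (R : realType) (n : nat).
Implicit Types (d l m x y : 'rV[R]_n).

(** The [k] smallest entries of [m] sum to at most its entries at the positions of the [k] smallest
    of [l]. *)
Lemma low_sum_sort_lip l m (eta : R) k : (k <= n)%N ->
  (forall i, `|m 0 i - l 0 i| <= eta) ->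
  low_sum (sort_up m) k <= low_sum (sort_up l) k + n%:R * eta.
Proof.
move=> kn ml; have [s ls] := sort_up_perm l.
apply: le_trans (low_sum_le_perm m s kn) _.
apply: (@le_trans _ _ (\sum_(i < n | (i < k)%N) (sort_up l 0 i + eta))).
  apply: ler_sum => i _; rewrite ls -lerBlDl.
  by apply: le_trans (ml (s i)); apply: ler_norm.
rewrite big_split/= lerD2l.
(* The sign of [eta] is known only through an index; for [n = 0] the sum is empty. *)
have [n0|[i0]] : n = 0%N \/ exists i : 'I_n, True.
- by case: (n) => [|n']; [left|right; exists ord0].
- have -> : n%:R = 0 :> R by rewrite n0.
  by rewrite mul0r big1// => i _; have := ltn_ord i; rewrite [X in (_ < X)%N]n0.
have eta0 : 0 <= eta by apply: le_trans (ml i0).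
rewrite mulr_natl -[n in X in _ <= X](card_ord n) -sumr_const.
by rewrite [leRHS](bigID (fun i : 'I_n => (i < k)%N))/= lerDl sumr_ge0.
Qed.

(** A positive [gap k] gives the room [t * gap k], which absorbs the perturbation of [l] into [m].
    If [gap k] vanishes, [m] is controlled by [d] directly, and the partial sums of [l] and [d]
    coincide. *)
Lemma majorized_segment l d y (t : R) : majorized l d ->
  (forall (s : {perm 'I_n}) k, (k <= n)%N ->
    low_sum (sort_up d) k <= \sum_(i < n | (i < k)%N) y 0 (s i)) ->
  \sum_i y 0 i = \sum_i d 0 i -> 0 < t -> t <= 1 ->
  exists2 eta, 0 < eta & forall m (s : {perm 'I_n}) x, majorized m d ->
    (forall i, `|m 0 i - l 0 i| <= eta) ->
    (forall k, x 0 k = (1 - t) * l 0 (s k) + t * y 0 k) -> majorized m x.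
Proof.
move=> ld yd ysum t0 t1.
pose gap k := low_sum (sort_up d) k - low_sum (sort_up l) k.
(* The value 1 is a placeholder for indices without positive gap. Dividing by [n.+1] makes [n * eta]
   fit in the gap and is safe for [n = 0]. *)
have [|eta eta0 /allP etaP] := @exists_pos_le R
    [seq if 0 < gap k then t * gap k / n.+1%:R else 1 | k <- iota 0 n.+1].
  apply/allP => _ /mapP[k _ ->]; case: ifP => //= gk.
  by rewrite divr_gt0// mulr_gt0.
exists eta => // m s x md ml xE.
have t1' : 0 <= 1 - t by rewrite subr_ge0.
have xsum : \sum_i x 0 i = \sum_i d 0 i.
  rewrite (eq_bigr _ (fun k _ => xE k)) big_split/= -!mulr_sumr ysum.
  have -> : \sum_i l 0 (s i) = \sum_i l 0 i.
    by rewrite [RHS](reindex_inj (@perm_inj _ s)).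
  by rewrite (majorized_sum ld); ring.
split; last first.
  by rewrite -!low_sum_full !sort_up_sum xsum; apply: majorized_sum.
move=> k /andP[_ kn']; have kn : (k <= n)%N by lia.
rewrite -!/(low_sum _ k); have [u xu] := sort_up_perm x.
have -> : low_sum (sort_up x) k =
    (1 - t) * (\sum_(i < n | (i < k)%N) l 0 ((u * s)%g i)) +
    t * (\sum_(i < n | (i < k)%N) y 0 (u i)).
  rewrite !mulr_sumr -big_split; apply: eq_bigr => i _.
  by rewrite xu xE permM.
have H1 := low_sum_le_perm l (u * s)%g kn.
have H2 := yd u k kn.
have H3 := majorized_low_sum ld kn; have H4 := majorized_low_sum md kn.
have K1 := ler_wpM2l t1' H1; have K2 := ler_wpM2l (ltW t0) H2.
apply: le_trans (lerD K1 K2); have [gk|gk] := ltP 0 (gap k).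
  apply: le_trans (low_sum_sort_lip kn ml) _.
  have : eta <= t * gap k / n.+1%:R.
    by apply: etaP; apply/mapP; exists k; rewrite ?gk// mem_iota.
  rewrite ler_pdivlMr ?ltr0Sn// => etak.
  have : n%:R * eta <= eta * n.+1%:R by rewrite mulrC ler_pM2l// ler_nat.
  by move: etak; rewrite /gap; lra.
move: gk; rewrite /gap subr_le0 => gk.
have e : low_sum (sort_up d) k = low_sum (sort_up l) k by apply/le_anti/andP.
by rewrite e in H4 *; move: H4; lra.
Qed.

End Perturbation.

Section SquaredFrobenius.
Variables (C : numClosedFieldType) (n : nat).

Lemma mxtrace_mul_adjE (X : 'M[C]_n) : \tr (X *m X^t*) = \sum_i \sum_j `|X i j| ^+ 2.
Proof.
apply: eq_bigr => i _; rewrite mxE; apply: eq_bigr => j _.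
by rewrite !mxE normCK.
Qed.

Lemma mxle_of_mxtrace (X : 'M[C]_n) (e : C) : 0 <= e -> \tr (X *m X^t*) <= e ^+ 2 ->
  mxle X e.
Proof.
move=> e0 Xe i j; rewrite -(@ler_pXn2r _ 2)// ?nnegrE//.
apply: le_trans Xe; rewrite mxtrace_mul_adjE (bigD1 i)//= (bigD1 j)//= -addrA lerDl.
by rewrite addr_ge0 ?sumr_ge0// => k _; rewrite ?sumr_ge0 ?exprn_ge0.
Qed.

(** The cross term sees only the diagonal of [H], so its spectrum and its diagonal alone decide how
    far [H] is from [diag_mx l], off-diagonal entries included. *)
Lemma mxtrace_sub_diag_sqr (H : 'M[C]_n) (l : 'rV[C]_n) : H^t* = H ->
  (diag_mx l)^t* = diag_mx l ->
  \tr ((H - diag_mx l) *m (H - diag_mx l)^t*) =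
  \tr (H *m H) - 2 * (\sum_i H i i * l 0 i) + \sum_i l 0 i ^+ 2.
Proof.
move=> Hh lh; rewrite adjmxB Hh lh mulmxBl !mulmxBr !linearB/=.
have -> : \tr (H *m diag_mx l) = \sum_i H i i * l 0 i.
  by apply: eq_bigr => i _; rewrite mul_mx_diag mxE.
rewrite [\tr (diag_mx l *m H)]mxtrace_mulC.
have -> : \tr (H *m diag_mx l) = \sum_i H i i * l 0 i.
  by apply: eq_bigr => i _; rewrite mul_mx_diag mxE.
have -> : \tr (diag_mx l *m diag_mx l) = \sum_i l 0 i ^+ 2.
  by apply: eq_bigr => i _; rewrite mul_mx_diag !mxE eqxx mulr1n expr2.
by ring.
Qed.

Lemma mxtrace_conjmx_sqr (U A : 'M[C]_n) : U \is unitarymx ->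
  \tr (U *m A *m U^t* *m (U *m A *m U^t*)) = \tr (A *m A).
Proof.
move=> Uu; rewrite !mulmxA -(mulmxA _ (U^t*) U) (unitarymxK Uu) mulmx1.
by rewrite mxtrace_mulC !mulmxA (unitarymxK Uu) mul1mx.
Qed.

End SquaredFrobenius.

(** * Averaging by the squared moduli of a unitary matrix *)

Section Averaging.
Variables (R : realType) (n : nat) (V : 'M[R[i]]_n).
Hypothesis Vu : V \is unitarymx.
Implicit Types (d : 'rV[R]_n).

(** The unistochastic matrix of [V], taken with values in [R] so that it acts on real vectors. *)
Definition sqweight i j : R := ComplexField.Normc.normc (V i j) ^+ 2.

Lemma sqweightE i j : (sqweight i j)%:C = `|V i j| ^+ 2.
Proof. by rewrite rmorphXn. Qed.

Lemma sqweight_ge0 i j : 0 <= sqweight i j.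
Proof. by rewrite -lecR sqweightE exprn_ge0. Qed.

Lemma sqweight_row i : \sum_j sqweight i j = 1.
Proof.
apply: complexI; rewrite rmorph_sum rmorph1.
have /matrixP/(_ i i) := unitarymxP Vu; rewrite !mxE eqxx mulr1n => <-.
by apply: eq_bigr => j _; rewrite !mxE -normCK -sqweightE.
Qed.

Lemma sqweight_col j : \sum_i sqweight i j = 1.
Proof.
apply: complexI; rewrite rmorph_sum rmorph1.
have /matrixP/(_ j j) := unitarymxK Vu; rewrite !mxE eqxx mulr1n => <-.
by apply: eq_bigr => i _; rewrite !mxE -normCKC -sqweightE.
Qed.

Definition averaged d : 'rV[R]_n := \row_i \sum_j sqweight i j * d 0 j.

Lemma averagedE d i :
  (V *m diag_mx (complexify d) *m V^t*) i i = (averaged d 0 i)%:C.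
Proof.
rewrite mxE [averaged _ _ _]mxE rmorph_sum; apply: eq_bigr => j _.
rewrite mul_mx_diag rmorphM /= sqweightE normCK !mxE.
by rewrite mulrAC.
Qed.

Lemma averaged_sum d : \sum_i averaged d 0 i = \sum_i d 0 i.
Proof.
under eq_bigr do rewrite mxE.
rewrite exchange_big; apply: eq_bigr => j _.
by rewrite -mulr_suml sqweight_col mul1r.
Qed.

(** Schur's half of the theorem: by double stochasticity, [k] rows of weights add up to coefficients
    in [[0, 1]] of total [k]. *)
Lemma low_sum_le_averaged d (s : {perm 'I_n}) k : (k <= n)%N ->
  low_sum (sort_up d) k <= \sum_(i < n | (i < k)%N) averaged d 0 (s i).
Proof.
move=> kn; under eq_bigr do rewrite mxE.
rewrite exchange_big/=; under eq_bigr do rewrite -mulr_suml.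
apply: low_sum_le_weighted => //.
  move=> j; rewrite sumr_ge0//=; last by move=> i _; apply: sqweight_ge0.
  rewrite -(sqweight_col j) [leRHS](reindex_inj (@perm_inj _ s))/=.
  rewrite [leRHS](bigID (fun i : 'I_n => (i < k)%N))/= lerDl.
  by rewrite sumr_ge0// => i _; apply: sqweight_ge0.
rewrite exchange_big/=; under eq_bigr do rewrite sqweight_row.
by rewrite big_mkcond/= -[RHS](sum_indicator R kn); apply: eq_bigr => i _; case: ifP.
Qed.

End Averaging.

(** * Lower semicontinuity of the fiber at one matrix *)

Section LowerSemicontinuity.
Variables (R : realType) (n : nat).
Implicit Types (d x y l m : 'rV[R]_n).

Lemma gt0_real_complex (a : R) : (0 < a%:C) = (0 < a).
Proof. by rewrite ltcE /= eqxx. Qed.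

(** Writing [<.,.>] for the scalar product and [l'] for [l] permuted by [s], the left side is
    [(|m|^2 - |l|^2) + 2 t (|l|^2 - <y, l'>)]; each summand is at most half of [e^2]. *)
Lemma sqr_dist_small l m x y (s : {perm 'I_n}) (t eta e : R) :
  0 <= t -> eta <= 1 ->
  t * (2 * `|\sum_i l 0 i ^+ 2 - \sum_i y 0 i * l 0 (s i)|) <= e ^+ 2 / 2 ->
  eta * (\sum_i (2 * `|l 0 i| + 1)) <= e ^+ 2 / 2 ->
  (forall i, `|m 0 i - l 0 i| <= eta) ->
  (forall i, x 0 i = (1 - t) * l 0 (s i) + t * y 0 i) ->
  \sum_i m 0 i ^+ 2 - 2 * (\sum_i x 0 i * l 0 (s i)) + \sum_i l 0 i ^+ 2
    <= e ^+ 2.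
Proof.
move=> t0 eta1 te etae ml xE.
have -> : \sum_i x 0 i * l 0 (s i) =
    (1 - t) * (\sum_i l 0 i ^+ 2) + t * (\sum_i y 0 i * l 0 (s i)).
  rewrite [in RHS](reindex_inj (@perm_inj _ s)) !mulr_sumr -big_split/=.
  by apply: eq_bigr => i _; rewrite xE; ring.
have h1 : \sum_i m 0 i ^+ 2 - \sum_i l 0 i ^+ 2 <= e ^+ 2 / 2.
  apply: le_trans etae; rewrite mulr_sumr -sumrB; apply: ler_sum => i _.
  rewrite subr_sqr (le_trans (ler_norm _))// normrM ler_pM//.
  have -> : m 0 i + l 0 i = 2 * l 0 i + (m 0 i - l 0 i) by ring.
  rewrite (le_trans (ler_normD _ _))// normrM ger0_norm// lerD2l.
  exact: le_trans (ml i) eta1.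
set S := \sum_i l 0 i ^+ 2 in te h1 *.
set T := \sum_i y 0 i * l 0 (s i) in te *.
have h2 : t * (2 * (S - T)) <= e ^+ 2 / 2.
  by apply: le_trans te; rewrite ler_wpM2l// ler_wpM2l// ler_norm.
by move: h1 h2; lra.
Qed.

(** The radius [dl] still depends on the matrix [A] of the fiber; compactness removes this
    dependence in [fiber_lower]. *)
Lemma fiber_lsc d (L : 'M[R]_n) (A : 'M[R[i]]_n) : Sd d L -> A^t* = A ->
  (forall i, A i i = (d 0 i)%:C) ->
  (forall z, mup z (char_poly (diag_mx (complexify (diagv L)))) =
             mup z (char_poly A)) ->
  forall e : R, 0 < e -> exists2 dl : R, 0 < dl &
  forall L', Sd d L' -> (forall i, `|diagv L' 0 i - diagv L 0 i| <= dl) ->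
  exists U, is_schur_horn_unitary d L' U /\ mxle (unitary_conj U L' - A) e%:C.
Proof.
move=> [Ld Lmaj] Ah Ad Aspec e e0; set l := diagv L in Lmaj Aspec *.
have [|dC dC0 correct] := correct_diag Ah (e := e%:C); first by rewrite gt0_real_complex.
have /complex_realP[r rE] : dC \is Num.real by rewrite gtr0_real.
have r0 : 0 < r by rewrite -gt0_real_complex -rE.
pose rt i := nat_of_ord (fingraph.root (mxgraph A) i).
have [|V [lam [w [Vu VA Vsum]]]] := @adapted_eigenbasis _ _ A rt Ah.
  move=> i j Aij; congr nat_of_ord; apply/eqP.
  rewrite root_connect; first exact: connect1.
  exact: mxgraph_connect_sym.
have [s lamE'] := conj_spectrum_perm Vu VA Aspec.
have lamE i : lam 0 i = (l 0 (s i))%:C by rewrite lamE' mxE.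
pose y := averaged V d.
have V'u : V^t* \is unitarymx by rewrite trmxC_unitary.
have VK X : V^t* *m (V *m X *m V^t*) *m V = X.
  by rewrite !mulmxA (unitarymxK Vu) mul1mx -mulmxA (unitarymxK Vu) mulmx1.
have AE : A = V^t* *m diag_mx lam *m V by rewrite -VA VK.
(* The permuted [l] and [y] both have the block sums of [A], the latter because [A] has diagonal
   [d]. Hence so does their convex combination [x], as [correct_diag] requires. *)
have lamsum v : \sum_(k | w k == v%:R) (l 0 (s k))%:C =
    \sum_(i | rt i == v) A i i.
  rewrite [in RHS]AE Vsum; apply: eq_bigr => k _.
  by rewrite [RHS]mxE eqxx mulr1n lamE.
have ysum v : \sum_(k | w k == v%:R) (y 0 k)%:C = \sum_(i | rt i == v) A i i.
  transitivity (\sum_(i | rt i == v) diag_mx (complexify d) i i).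
    rewrite -(VK (diag_mx (complexify d))) Vsum; apply: eq_bigr => k _.
    by rewrite averagedE.
  by apply: eq_bigr => i _; rewrite Ad !mxE eqxx mulr1n.
(* Conjugating by [V^t*] costs a factor [n * n] in entrywise bounds; the [+ 1] keeps the denominator
   positive. *)
pose e2 := r / (n%:R * n%:R + 1).
have nn0 : 0 < n%:R * n%:R + 1 :> R by rewrite ltr_wpDl// mulr_ge0.
have e20 : 0 < e2 by rewrite divr_gt0.
pose K2 := 2 * `|\sum_i l 0 i ^+ 2 - \sum_i y 0 i * l 0 (s i)|.
pose K1 := \sum_i (2 * `|l 0 i| + 1).
have K20 : 0 <= K2 by rewrite mulr_ge0.
have K10 : 0 <= K1 by rewrite sumr_ge0// => i _; rewrite addr_ge0// mulr_ge0.
have K21 : 0 < K2 + 1 by rewrite ltr_wpDl.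
have K11 : 0 < K1 + 1 by rewrite ltr_wpDl.
have e22 : 0 < e2 ^+ 2 / 2 by rewrite divr_gt0// exprn_gt0.
(* The step [t] is fixed before [dl], because the radius [eta] given by [majorized_segment] depends
   on it. Each of [t] and [dl] accounts for half of [e2 ^+ 2] in [sqr_dist_small]. *)
have [|t t0 /=/and3P[t1 te _]] :=
    @exists_pos_le R [:: 1; e2 ^+ 2 / 2 / (K2 + 1)].
  by rewrite /= ltr01 divr_gt0.
have [eta eta0 seg] := majorized_segment Lmaj (low_sum_le_averaged Vu d)
  (averaged_sum Vu d) t0 t1.
have [|dl dl0 /=/and4P[dl1 dle dleta _]] :=
    @exists_pos_le R [:: 1; e2 ^+ 2 / 2 / (K1 + 1); eta].
  by rewrite /= ltr01 eta0 divr_gt0.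
exists dl => // L' L'S L'L; have [L'd L'maj] := L'S.
pose x : 'rV[R]_n := \row_k ((1 - t) * l 0 (s k) + t * y 0 k).
have xE k : x 0 k = (1 - t) * l 0 (s k) + t * y 0 k by rewrite mxE.
have L'x : Sd x L'.
  split=> //; apply: (seg _ s x L'maj _ xE) => i.
  exact: le_trans (L'L i) dleta.
have [Q [Qu Qd]] := schur_horn_exists L'x.
set H := unitary_conj Q L' in Qd.
have Hh : H^t* = H by exact: unitary_conj_herm.
have Hd k : H k k = (x 0 k)%:C by move/rowP: Qd => /(_ k); rewrite !mxE.
have lamh : (diag_mx lam)^t* = diag_mx lam.
  rewrite -VA; exact: herm_conjmx.
have Hlam : mxle (H - diag_mx lam) e2%:C.
  apply: mxle_of_mxtrace; first by rewrite ler0c ltW.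
  rewrite mxtrace_sub_diag_sqr// mxtrace_conjmx_sqr//.
  have -> : \tr (complexify L' *m complexify L') =
      (\sum_i diagv L' 0 i ^+ 2)%:C.
    rewrite complexify_diag// rmorph_sum; apply: eq_bigr => i _.
    by rewrite mul_mx_diag !mxE eqxx mulr1n rmorphXn expr2.
  have -> : \sum_i H i i * lam 0 i = (\sum_i x 0 i * l 0 (s i))%:C.
    by rewrite rmorph_sum; apply: eq_bigr => i _; rewrite Hd lamE rmorphM.
  have -> : \sum_i lam 0 i ^+ 2 = (\sum_i l 0 i ^+ 2)%:C.
    rewrite [in RHS](reindex_inj (@perm_inj _ s)) rmorph_sum.
    by apply: eq_bigr => i _; rewrite lamE rmorphXn.
  have -> : 2 = (2 : R)%:C :> R[i] by rewrite rmorph_nat.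
  rewrite -rmorphM -rmorphB -rmorphD -rmorphXn lecR.
  apply: (@sqr_dist_small l (diagv L') x y s t dl e2 (ltW t0) dl1) => //.
    move: te; rewrite ler_pdivlMr// mulrDr mulr1; apply: le_trans.
    by rewrite lerDl ltW.
  move: dle; rewrite ler_pdivlMr// mulrDr mulr1; apply: le_trans.
  by rewrite lerDl ltW.
pose B := V^t* *m H *m V.
have Bh : B^t* = B.
  by have := herm_conjmx (V^t*) Hh; rewrite trmxCK.
have BA : mxle (B - A) dC.
  have := mxle_conjmx V'u Hlam; rewrite trmxCK -AE -/B => h.
  apply: mxle_trans h _.
  rewrite rE -!(rmorph_nat (real_complex R)) -!rmorphM lecR mulrA mulrC.
  rewrite /e2 mulrAC ler_pdivrMr// ler_pM2l//.
  by rewrite lerDl.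
have Bsum v : \sum_(k | fingraph.root (mxgraph A) k == v) B k k =
    \sum_(k | fingraph.root (mxgraph A) k == v) A k k.
  transitivity (\sum_(k | rt k == v) B k k); first exact: eq_bigl.
  transitivity (\sum_(k | rt k == v) A k k); last exact: eq_bigl.
  rewrite Vsum; under eq_bigr do rewrite Hd xE rmorphD !rmorphM/=.
  rewrite big_split/= -!mulr_sumr lamsum ysum -mulrDl -rmorphD subrK.
  by rewrite mul1r.
have [W [Wu WA Wd]] := correct B Bh BA Bsum.
exists (W *m (V^t* *m Q)).
have WE : unitary_conj (W *m (V^t* *m Q)) L' = W *m B *m W^t*.
  by rewrite /unitary_conj !adjmxM trmxCK /B /H /unitary_conj !mulmxA.
split; last by rewrite WE.
split; first exact: mul_unitarymx Wu (mul_unitarymx V'u Qu).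
by apply/rowP => i; rewrite mxE WE Wd Ad mxE.
Qed.

End LowerSemicontinuity.

(** * Compactness and continuity *)

Section Compactness.
Variable R : realType.

(** Compactness of the cube, stated with arbitrarily late indices [k] instead of an extracted
    subsequence. *)
Lemma bounded_rV_seq_cluster N (v : nat -> 'rV[R]_N) :
  (forall k i, `|v k 0 i| <= 1) -> exists2 p : 'rV[R]_N,
  forall i, `|p 0 i| <= 1 & forall e, 0 < e -> forall K, exists2 k,
    (K <= k)%N & forall i, `|v k 0 i - p 0 i| < e.
Proof.
move=> v1; pose I (i : 'I_N) : set R := [set` `[-1 : R, 1]].
have Ic : compact [set w : 'rV[R]_N | forall i, I i (w ord0 i)].
  by apply: rV_compact => i; apply: segment_compact.
have vI : (v @ \oo) [set w : 'rV[R]_N | forall i, I i (w ord0 i)].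
  by exists 0%N => // k _ i; rewrite /I /= in_itv/= -ler_norml; exact: v1.
have [p [pI pcl]] := Ic (v @ \oo) _ vI.
exists p; first by move=> i; have := pI i; rewrite /I /= in_itv/= -ler_norml.
move=> e e0 K.
have tail : (v @ \oo) [set v k | k in [set k | (K <= k)%N]].
  by exists K => // k /= Kk; exists k.
have [_ [[k Kk <-] kp]] := pcl _ _ tail (nbhsx_ballx p e e0).
exists k => // i; rewrite distrC.
by case: kp => _ /(_ 0 i).
Qed.

Variable n : nat.
Implicit Types (U V A : 'M[R[i]]_n).

Lemma mxle_eq0 m p (X : 'M[R[i]]_(m, p)) :
  (forall e : R, 0 < e -> mxle X e%:C) -> X = 0.
Proof.
move=> Xe; apply/matrixP => i j; rewrite mxE; apply/eqP; rewrite -normr_le0.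
have /complex_realP[r rE] : `|X i j| \is Num.real by [].
rewrite rE lecE /= eqxx /= leNgt; apply/negP => r0.
have := Xe (r / 2) (divr_gt0 r0 (ltr0Sn _ 1)) i j; rewrite rE lecR.
by move: r0; lra.
Qed.

Lemma mxle_conjmx_dist U V A (a M e : R[i]) : mxle U a -> mxle V a ->
  mxle A M -> mxle (U - V) e ->
  mxle (U *m A *m U^t* - V *m A *m V^t*)
    (n%:R * (n%:R * (e * M) * a) + n%:R * (n%:R * (a * M) * e)).
Proof.
move=> Ua Va AM UV.
have -> : U *m A *m U^t* - V *m A *m V^t* =
    (U - V) *m A *m U^t* + V *m A *m (U - V)^t*.
  by rewrite adjmxB mulmxBr !mulmxBl addrA subrK.
by apply: mxleD; apply: mxleM (mxleM _ _) (mxle_adj _).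
Qed.

Lemma normc_le_norms (a b : R) :
  ComplexField.Normc.normc (a +i* b)%C <= `|a| + `|b|.
Proof.
have ab0 : 0 <= `|a| + `|b| by rewrite addr_ge0.
rewrite -[leRHS]ger0_norm// -sqrtr_sqr ler_wsqrtr// sqrrD !real_normK ?num_real//.
by rewrite lerD2r lerDl mulrn_wge0// mulr_ge0.
Qed.

(** Real and imaginary parts of the entries form bounded real vectors. The limit is unitary because
    [U k *m (U k)^t*] is constantly 1 and comes arbitrarily close to [V *m V^t*]. *)
Lemma unitary_cluster (U : nat -> 'M[R[i]]_n) :
  (forall k, U k \is unitarymx) -> exists2 V, V \is unitarymx &
  forall e, 0 < e -> forall K, exists2 k,
    (K <= k)%N & mxle (U k - V) e%:C.
Proof.
move=> Uu.
pose v k : 'rV[R]_(n * n + n * n) :=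
  row_mx (mxvec (map_mx (@complex.Re R) (U k)))
         (mxvec (map_mx (@complex.Im R) (U k))).
have normRe (z : R[i]) : `|complex.Re z| <= ComplexField.Normc.normc z.
  by case: z => a b /=; rewrite -sqrtr_sqr ler_wsqrtr// lerDl sqr_ge0.
have normIm (z : R[i]) : `|complex.Im z| <= ComplexField.Normc.normc z.
  by case: z => a b /=; rewrite -sqrtr_sqr ler_wsqrtr// lerDr sqr_ge0.
have U1 k i j : ComplexField.Normc.normc (U k i j) <= 1.
  by rewrite -lecR; exact: (mxle_unitary (Uu k) i j).
have [|p p1 pcl] := @bounded_rV_seq_cluster _ v.
  move=> k i; rewrite mxE; case: splitP => j _; case/mxvec_indexP: j => j1 j2;
  rewrite mxvecE mxE; exact: le_trans (U1 k j1 j2).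
pose V : 'M[R[i]]_n := \matrix_(i, j)
  (p 0 (lshift _ (mxvec_index i j)) +i* p 0 (rshift _ (mxvec_index i j))).
have cl e : 0 < e -> forall K, exists2 k, (K <= k)%N & mxle (U k - V) e%:C.
  move=> e0 K; have [|k Kk kp] := pcl (e / 2) _ K; first by rewrite divr_gt0.
  exists k => // i j.
  have := kp (lshift _ (mxvec_index i j)); have := kp (rshift _ (mxvec_index i j)).
  rewrite row_mxEl row_mxEr !mxvecE !mxE.
  case: (U k i j) => a b /= hb ha.
  set a' := p 0 _ in ha *; set b' := p 0 _ in hb *.
  have -> : (a +i* b)%C - (a' +i* b')%C = ((a - a') +i* (b - b'))%C by simpc.
  rewrite lecR; apply: le_trans (normc_le_norms _ _) _.
  by rewrite [leRHS](splitr e) lerD// ltW.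
(* A crude bound from the two coordinates, since [V] is not yet known to be unitary. *)
have V2 : mxle V 2%:R.
  move=> i j; rewrite mxE; apply: (@le_trans _ _ (2 : R)%:C).
    rewrite lecR; apply: le_trans (normc_le_norms _ _) _.
    by rewrite [leRHS](_ : _ = 1 + 1)// lerD.
  by rewrite rmorph_nat.
exists V => //; apply/unitarymxP/eqP; rewrite -subr_eq0; apply/eqP.
apply: mxle_eq0 => e e0; pose K : R := n%:R * (n%:R * 2) + n%:R * (n%:R * 2).
have K0 : 0 <= K by rewrite addr_ge0// !mulr_ge0.
have K1 : 0 < K + 1 by rewrite ltr_wpDl.
have [|k _ Uk] := cl (e / (K + 1)) _ 0%N; first by rewrite divr_gt0.
have I1 := mxle_unitary (unitarymx1 R[i] n).
have U2 : mxle (U k) 2%:R by apply: mxle_trans (mxle_unitary (Uu k)) _; rewrite ler1n.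
have := mxle_conjmx_dist U2 V2 I1 Uk; rewrite !mulmx1 (unitarymxP (Uu k)).
move=> /mxle_distC h; apply: mxle_trans h _.
rewrite !mulr1 -!(rmorph_nat (real_complex R)) -!rmorphM -rmorphD lecR.
rewrite [leLHS](_ : _ = K * (e / (K + 1))); last by rewrite /K; ring.
by rewrite mulrCA ler_piMr ?(ltW e0)// ler_pdivrMr// mul1r lerDl.
Qed.

End Compactness.

(** * Uniform estimates on the fibers and the Hausdorff distance *)

Section Continuity.
Variables (R : realType) (n : nat).
Implicit Types (d : 'rV[R]_n) (L : 'M[R]_n) (U V A : 'M[R[i]]_n).

Lemma normc_ge0 (z : R[i]) : 0 <= ComplexField.Normc.normc z.
Proof. by case: z => a b; apply: sqrtr_ge0. Qed.

Lemma entry_le_frobenius A i j : `|A i j| <= (frobenius A)%:C.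
Proof.
rewrite lecR /frobenius -[leLHS]ger0_norm ?normc_ge0// -sqrtr_sqr ler_wsqrtr//.
rewrite (bigD1 i)//= (bigD1 j)//= -addrA lerDl addr_ge0// sumr_ge0// => k _.
  by rewrite sqr_ge0.
by rewrite sumr_ge0// => l _; rewrite sqr_ge0.
Qed.

Lemma frobenius_le A (e : R) : 0 <= e -> mxle A e%:C -> frobenius A <= n%:R * e.
Proof.
move=> e0 Ae; have ne0 : 0 <= n%:R * e by rewrite mulr_ge0.
rewrite /frobenius -[leRHS]ger0_norm// -sqrtr_sqr ler_wsqrtr//.
apply: (@le_trans _ _ (\sum_(i < n) \sum_(j < n) e ^+ 2)).
  apply: ler_sum => i _; apply: ler_sum => j _.
  by rewrite ler_pXn2r ?nnegrE ?normc_ge0// -lecR; exact: Ae.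
by rewrite !sumr_const card_ord -mulrnA -[_ *+ (n * n)]mulr_natl natrM exprMn.
Qed.

Lemma mxle_complexify_dist L L' (e : R) :
  frobenius (complexify (L' - L)) < e ->
  mxle (complexify L' - complexify L) e%:C.
Proof.
move=> Le i j; have -> : complexify L' - complexify L = complexify (L' - L).
  by rewrite /complexify map_mxB.
by apply: le_trans (entry_le_frobenius _ _ _) _; rewrite lecR ltW.
Qed.

Lemma mxle_diagv_dist L L' (e : R) :
  mxle (complexify L' - complexify L) e%:C ->
  forall i, `|diagv L' 0 i - diagv L 0 i| <= e.
Proof.
move=> Le i; have := Le i i; rewrite !mxE -rmorphB lecR.
by rewrite /= expr0n addr0 sqrtr_sqr.
Qed.

Lemma harmonic_small (e : R) : 0 < e ->
  exists K : nat, forall k, (K <= k)%N -> k.+1%:R^-1 <= e.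
Proof.
move=> e0; exists (Num.bound e^-1) => k Kk.
rewrite invf_ple ?posrE//; apply: ltW; apply: lt_le_trans (_ : k%:R <= _).
  apply: lt_le_trans (archi_boundP _) _; first by rewrite invr_ge0 ltW.
  by rewrite ler_nat.
by rewrite ler_nat.
Qed.

(** The error is split at [U k *m complexify L *m (U k)^t*]: the rate of [L_] bounds one half, the
    cluster point of [U] the other. *)
Lemma unitary_conj_cluster L (U : nat -> 'M[R[i]]_n) (L_ : nat -> 'M[R]_n) :
  (forall k, U k \is unitarymx) ->
  (forall k, mxle (complexify (L_ k) - complexify L) (k.+1%:R^-1)%:C) ->
  exists2 V, V \is unitarymx & forall e, 0 < e -> forall K, exists2 k,
    (K <= k)%N & mxle (unitary_conj (U k) (L_ k) - unitary_conj V L) e%:C.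
Proof.
move=> Uu LL; have [V Vu Vcl] := unitary_cluster Uu; exists V => // e e0 K.
have [M' M'0 LM'] := mxle_bounded (complexify L).
have /complex_realP[M ME] : M' \is Num.real by rewrite gtr0_real.
have M0 : 0 < M by rewrite -gt0_real_complex -ME.
pose N : R := n%:R; have N0 : 0 <= N by rewrite ler0n.
pose c := N * (N * M) + N * (N * M).
have c1 : 0 < c + 1 by rewrite ltr_wpDl// addr_ge0// !mulr_ge0// ltW.
have N1 : 0 < N * N + 1 by rewrite ltr_wpDl// mulr_ge0.
have [|K1 K1P] := @harmonic_small (e / 2 / (N * N + 1)).
  by rewrite !divr_gt0.
have [|k Kk Uk] := Vcl (e / 2 / (c + 1)) _ (maxn K K1).
  by rewrite !divr_gt0.
have [Kk' K1k] : (K <= k)%N /\ (K1 <= k)%N.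
  by move: Kk; rewrite geq_max => /andP.
exists k => //.
have h1 := mxle_conjmx (Uu k) (LL k).
have h2 := mxle_conjmx_dist (mxle_unitary (Uu k)) (mxle_unitary Vu) LM' Uk.
apply: mxle_trans (mxle_dist_trans h1 h2) _.
rewrite ME !mulr1 !mul1r -!(rmorph_nat (real_complex R)) -!rmorphM -!rmorphD lecR.
rewrite [leRHS](splitr e) lerD//.
  have := K1P k K1k; rewrite ler_pdivlMr// => h.
  apply: le_trans h; rewrite mulrA mulrC ler_wpM2l ?invr_ge0//.
  by rewrite lerDl.
rewrite [leLHS](_ : _ = c * (e / 2 / (c + 1))); last by rewrite /c; ring.
by rewrite mulrCA ler_piMr ?divr_ge0 ?(ltW e0)// ler_pdivrMr// mul1r lerDl.
Qed.

Lemma schur_horn_unitary_cluster d L V (U : nat -> 'M[R[i]]_n)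
    (L_ : nat -> 'M[R]_n) : V \is unitarymx ->
  (forall k, is_schur_horn_unitary d (L_ k) (U k)) ->
  (forall e, 0 < e -> forall K, exists2 k,
    (K <= k)%N & mxle (unitary_conj (U k) (L_ k) - unitary_conj V L) e%:C) ->
  is_schur_horn_unitary d L V.
Proof.
move=> Vu Ud cl; split=> //; apply/eqP; rewrite -subr_eq0; apply/eqP.
apply: mxle_eq0 => e e0; have [k _ kV] := cl e e0 0%N.
have [_ Udk] := Ud k; apply: mxle_distC => i j.
have := kV j j; have /rowP/(_ j) := Udk; rewrite (ord1 i) !mxE => ->.
by [].
Qed.

(** Upper semicontinuity by compactness: counterexamples with [L'] tending to [L] would cluster at a
    matrix of the fiber of [L]. *)
Lemma fiber_upper d L : Sd d L -> forall e : R, 0 < e ->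
  exists2 dl : R, 0 < dl & forall L' U, Sd d L' ->
    frobenius (complexify (L' - L)) < dl -> is_schur_horn_unitary d L' U ->
    exists2 V, is_schur_horn_unitary d L V &
      mxle (unitary_conj U L' - unitary_conj V L) e%:C.
Proof.
move=> dL e e0; apply: contrapT => no.
have bad k : exists LU : 'M[R]_n * 'M[R[i]]_n, [/\
    frobenius (complexify (LU.1 - L)) < k.+1%:R^-1,
    is_schur_horn_unitary d LU.1 LU.2 &
    ~ exists2 V, is_schur_horn_unitary d L V &
      mxle (unitary_conj LU.2 LU.1 - unitary_conj V L) e%:C].
  apply: contrapT => nok; apply: no; exists k.+1%:R^-1; first by rewrite invr_gt0.
  move=> L' U dL' L'L UL'; apply: contrapT => noV; apply: nok.
  by exists (L', U).
have [f fP] := choice bad.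
have [k|k|V Vu Vcl] := @unitary_conj_cluster L (fun k => (f k).2) (fun k => (f k).1).
- by have [_ []] := fP k.
- by have [h _ _] := fP k; apply: mxle_complexify_dist.
have VL : is_schur_horn_unitary d L V.
  by apply: (schur_horn_unitary_cluster Vu _ Vcl) => k; have [] := fP k.
have [k _ kV] := Vcl e e0 0%N.
by have [_ _] := fP k; apply; exists V.
Qed.

(** Counterexamples in the fiber of [L] cluster at one matrix of that fiber. There [fiber_lsc]
    applies with precision [e / 2], and the triangle inequality rules out a late counterexample. *)
Lemma fiber_lower d L : Sd d L -> forall e : R, 0 < e ->
  exists2 dl : R, 0 < dl & forall L' U, Sd d L' ->
    frobenius (complexify (L' - L)) < dl -> is_schur_horn_unitary d L U ->
    exists2 V, is_schur_horn_unitary d L' V &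
      mxle (unitary_conj V L' - unitary_conj U L) e%:C.
Proof.
move=> dL e e0; apply: contrapT => no.
have bad k : exists LU : 'M[R]_n * 'M[R[i]]_n, [/\ Sd d LU.1,
    frobenius (complexify (LU.1 - L)) < k.+1%:R^-1,
    is_schur_horn_unitary d L LU.2 &
    ~ exists2 V, is_schur_horn_unitary d LU.1 V &
      mxle (unitary_conj V LU.1 - unitary_conj LU.2 L) e%:C].
  apply: contrapT => nok; apply: no; exists k.+1%:R^-1; first by rewrite invr_gt0.
  move=> L' U dL' L'L UL'; apply: contrapT => noV; apply: nok.
  by exists (L', U).
have [f fP] := choice bad.
have [k|k|V Vu Vcl] := @unitary_conj_cluster L (fun k => (f k).2) (fun=> L).
- by have [_ _ []] := fP k.
- by rewrite subrr => i j; rewrite mxE normr0 ler0c invr_ge0.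
have [_ VL] : is_schur_horn_unitary d L V.
  by apply: (schur_horn_unitary_cluster Vu _ Vcl) => k; have [] := fP k.
have e20 : 0 < e / 2 by rewrite divr_gt0.
have [Ld _] := dL.
have Ad i : unitary_conj V L i i = (d 0 i)%:C.
  by have /rowP/(_ i) := VL; rewrite !mxE.
have Asp z : mup z (char_poly (diag_mx (complexify (diagv L)))) =
    mup z (char_poly (unitary_conj V L)).
  by rewrite (char_poly_unitary_conj L Vu) (complexify_diag Ld).
have [dl dl0 lsc] := fiber_lsc dL (unitary_conj_herm V Ld) Ad Asp e20.
have [K KP] := harmonic_small dl0.
have [k Kk kV] := Vcl _ e20 K.
have [dL' L'L UL] := fP k; apply.
have L'L' := lt_le_trans L'L (KP k Kk).
have [W [WL' WV]] := lsc _ dL' (mxle_diagv_dist (mxle_complexify_dist L'L')).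
exists W => //.
have := mxle_dist_trans WV (mxle_distC kV).
by rewrite -rmorphD -splitr.
Qed.

Lemma schur_horn_map_fun d : set_fun (Sd d) (Nquot d) (schur_horn_map d).
Proof.
move=> L dL; have [Q QP] := schur_horn_exists dL; have [Ld _] := dL.
rewrite (schur_horn_mapE QP); exists (unitary_conj Q L) => //.
by have [_ Qd] := QP; split; [exact: Qd | rewrite unitary_conj_herm].
Qed.

Lemma schur_horn_map_continuous d : continuous_on_Sd d (schur_horn_map d).
Proof.
(* An entrywise bound costs a factor [n] in Frobenius norm. Aiming at [e / 2] restores the strict
   inequality, since suprema only preserve weak ones. *)
move=> L dL e e0; pose e1 := e / 2 / n.+1%:R.
have e10 : 0 < e1 by rewrite !divr_gt0.
have frob_small A : mxle A e1%:C -> frobenius A <= e / 2.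
  move=> /(frobenius_le (ltW e10)) h; apply: le_trans h _.
  rewrite /e1 mulrCA ler_piMr ?divr_ge0 ?(ltW e0)// ler_pdivrMr// mul1r.
  by rewrite ler_nat.
have [d1 d10 P1] := fiber_upper dL e10.
have [d2 d20 P2] := fiber_lower dL e10.
exists (Num.min d1 d2); first by rewrite lt_min d10.
move=> L' dL'; rewrite lt_min => /andP[L'1 L'2].
rewrite (@le_lt_trans _ _ (e / 2)%:E)//; last first.
  by rewrite lte_fin ltr_pdivrMr// ltr_pMr// ltr1n.
rewrite /dist_hausdorff ge_max; apply/andP; split; apply: ub_ereal_sup.
  move=> _ [X /(schur_horn_mapP _ dL')[U UL' ->] <-].
  have [V VL VU] := P1 _ _ dL' L'1 UL'.
  apply: le_trans (_ : (frobenius (unitary_conj U L' - unitary_conj V L))%:E <= _)%E.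
    apply: ereal_inf_lbound; exists (unitary_conj V L); last by reflexivity.
    by apply/(schur_horn_mapP _ dL); exists V.
  by rewrite lee_fin (frob_small _ VU).
move=> _ [Y /(schur_horn_mapP _ dL)[U UL ->] <-].
have [V VL' VU] := P2 _ _ dL' L'2 UL.
apply: le_trans (_ : (frobenius (unitary_conj V L' - unitary_conj U L))%:E <= _)%E.
  apply: ereal_inf_lbound; exists (unitary_conj V L'); last by reflexivity.
  by apply/(schur_horn_mapP _ dL'); exists V.
by rewrite lee_fin (frob_small _ VU).
Qed.

End Continuity.

Theorem corollary1p6 (R : realType) (n : nat) (d : 'rV[R]_n) :
  set_fun (Sd d) (Nquot d) (schur_horn_map d) /\
  continuous_on_Sd d (schur_horn_map d).
Proof.
split; [exact: schur_horn_map_fun | exact: schur_horn_map_continuous].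
Qed.
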